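(* Assume that one of the covariate settings (K) or [(C1) and (C2)] holds, and that one of the tail conditions (P) or (E) holds (all defined in the context, with the constants $p$, $L$, $\lambda$ and the set $I$ appearing there). Define \[ c_n = \begin{cases} 4p^{-1/2}n^{-1/2 + 1/\lambda}\log(n)^{1/2 + 1/\lambda}, & \text{under (K) and (P)}, \\ 8p^{-1/2}\lambda^{-1}n^{-1/2}\log(n)^{3/2}, & \text{under (K) and (E)}, \\ [4p^{-1/2} + L]\, n^{-1/3 + 2/(3\lambda)}\log(n)^{1/3 + 2/(3\lambda)}, & \text{under (C1), (C2), and (P)}, \\ (2/\lambda)^{2/3}[4p^{-1/2} + L]\,n^{-1/3}\log(n), & \text{under (C1), (C2), and (E)}, \end{cases} \] and \[ I_n = \begin{cases} \{1, \dots, K\}, & \text{under (K)}, \\ \{x \in I: \, x \pm n^{-1/3 + 2/(3\lambda)}\log(n)^{1/3 + 2/(3\lambda)} \in I\}, & \text{under (C1), (C2), and (P)}, \\ \{x \in I: \, x \pm (2/\lambda)^{2/3}n^{-1/3}\log(n) \in I\}, & \text{under (C1), (C2), and (E)}. \end{cases} \] Then \[ \lim_{n \rightarrow \infty} \mathbb{P}\left(\sup_{y \in \mathbb{R}, \, x \in I_n} |\tilde{M}_{n;x}(y) - M_{x}(y)| \geq c_n \right) = 0. \]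
   Context: Notation: $(z)_+ = \max(z,0)$; ''increasing'' and ''decreasing'' are meant in the weak sense; $x\pm\delta\in I$ means both $x-\delta\in I$ and $x+\delta\in I$. Model. $(F_x)_{x\in I}$, $I\subseteq\mathbb{R}$, is a family of cumulative distribution functions (CDFs) on $\mathbb{R}$ with finite first moments, and $M_x(y) = \int_{-\infty}^y F_x(t)\,dt$, i.e. $M_x(y)=\mathbb{E}[(y-Y)_+]$ for $Y\sim F_x$. The family is increasing in $x$ in the increasing concave order: $M_x(y)\ge M_{x'}(y)$ for all $y\in\mathbb{R}$ whenever $x\le x'$. The family does not depend on $n$. Let $(X_{ni},Y_{ni})$, $i=1,\dots,n$, $n\in\mathbb{N}$, be a triangular array of real random pairs on a probability space with probability measure $\mathbb{P}$. For each $n$, the covariates $X_{n1},\dots,X_{nn}$ are independent and take values in $I$; conditionally on $X_{n1},\dots,X_{nn}$, the responses $Y_{n1},\dots,Y_{nn}$ are independent, and the conditional CDF of $Y_{ni}$ is $F_{X_{ni}}$. Estimator. Fix $n$. Let $x_1<\dots<x_d$ be the distinct values of $X_{n1},\dots,X_{nn}$, $w_i=\#\{j\le n: X_{nj}=x_i\}$ and $h_i(y)=\frac{1}{w_i}\sum_{j: X_{nj}=x_i}(y-Y_{nj})_+$. For each $y\in\mathbb{R}$, $(\tilde M_{n;x_1}(y),\dots,\tilde M_{n;x_d}(y))$ is the unique minimizer of $\sum_{i=1}^d w_i[\eta_i-h_i(y)]^2$ over all $\eta\in\mathbb{R}^d$ with $\eta_1\ge\dots\ge\eta_d$. Equivalently,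 \[ \tilde M_{n;x_i}(y)=\min_{k=1,\dots,i}\ \max_{j=k,\dots,d}\ \frac{\sum_{s=k}^j w_sh_s(y)}{\sum_{s=k}^j w_s}. \] For $x\notin\{x_1,\dots,x_d\}$, $\tilde M_{n;x}(y)$ is any choice satisfying $\tilde M_{n;x_i}(y)\ge\tilde M_{n;x}(y)\ge\tilde M_{n;x_{i+1}}(y)$ for all $y\in\mathbb{R}$ if $x\in[x_i,x_{i+1})$, $\tilde M_{n;x}(y)=\tilde M_{n;x_1}(y)$ if $x<x_1$, and $\tilde M_{n;x}(y)=\tilde M_{n;x_d}(y)$ if $x\ge x_d$. Covariate conditions (constants do not depend on $n$ or $i$). (K) $I=\{1,\dots,K\}$ for some $K\in\mathbb{N}$, the covariates take values in $I$, and $\min_{j=1,\dots,K}\mathbb{P}(X_{ni}=j)=p$ for some $p>0$. (C1) $I$ is an interval, and the covariates $X_{n1},\dots,X_{nn}$ admit a Lebesgue density that is bounded from below by some $p>0$ on $I$. (C2) There exists a constant $L>0$ such that $|M_u(y)-M_v(y)|\le L|u-v|$ for all $u,v\in I$ and $y\in\mathbb{R}$. Tail conditions, with $I$ the set from (K) or from (C1), (C2), and where $\mathbb{P}(|Y|\ge y\mid X=x)$ denotes the probability of $\{|Y|\ge y\}$ for $Y\sim F_x$. (P) There exist $\lambda>2$ and $y_0\ge0$ such that $\mathbb{P}(|Y|\ge y\mid X=x)\le y^{-\lambda}$ for all $y\ge y_0$ and $x\in I$. (E) There exist $\lambda>0$ and $y_0\ge0$ such that $\mathbb{P}(|Y|\ge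 y\mid X=x)\le\exp(-\lambda y)$ for all $y\ge y_0$ and $x\in I$. *)

(* Defs.v *)
From HB Require Import structures.
From mathcomp Require Import all_boot all_order all_algebra.
From mathcomp Require Import all_classical all_reals all_analysis.

Set Implicit Arguments.
Unset Strict Implicit.
Unset Printing Implicit Defensive.
Import Order.TTheory GRing.Theory Num.Theory.
Import numFieldNormedType.Exports.

Local Open Scope classical_set_scope.
Local Open Scope ring_scope.

Section probability_model.
Context d (Omega : measurableType d) (R : realType) (P : probability Omega R).

Definition mutually_independent n (X : 'I_n -> {RV P >-> R}) : Prop :=
  forall B : 'I_n -> set R, (forall i, measurable (B i)) ->
    P (\bigcap_i (X i @^-1` B i)) = (\prod_(i < n) P (X i @^-1` B i))%E.

(* [g] is a version of the conditional probability of [E] given the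
   sigma-algebra [G]. *)
Definition is_cond_prob (G : set (set Omega)) (E : set Omega)
    (g : Omega -> R) : Prop :=
  [/\ forall B : set R, measurable B -> G (g @^-1` B),
      P.-integrable setT (EFin \o g) &
      forall A, G A -> (\int[P]_(w in A) (g w)%:E = P (A `&` E))%E].

(* Since versions agree almost surely, quantifying over all versions amounts to
   the almost sure identity between conditional probabilities. *)
Definition cond_independent (G : set (set Omega)) n
    (Y : 'I_n -> {RV P >-> R}) : Prop :=
  forall (B : 'I_n -> set R) (g : 'I_n -> Omega -> R),
    (forall i, measurable (B i)) ->
    (forall i, is_cond_prob G (Y i @^-1` B i) (g i)) ->
    is_cond_prob G (\bigcap_i (Y i @^-1` B i)) (fun w => \prod_(i < n) g i w).

(* The family of distribution functions is indexed by all of [R]; every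
   condition on it, here and below, only concerns indices in [I]. *)
Definition sampling_model (I : set R) (F : R -> cumulativeBounded (0 : R) (1 : R))
    n (X Y : 'I_n -> {RV P >-> R}) : Prop :=
  let G := g_sigma_preimage (fun i : 'I_n => X i : Omega -> R) in
  [/\ mutually_independent X,
      forall i w, I (X i w),
      cond_independent G Y &
      forall i y, is_cond_prob G (Y i @^-1` `]-oo, y]) (fun w => F (X i w) y)].

End probability_model.

Section cdf_family.
Context (R : realType).
Implicit Types (I : set R) (F : R -> cumulativeBounded (0 : R) (1 : R)).

Definition finite_first_moments I F : Prop :=
  forall x, I x ->
    (lebesgue_stieltjes_measure (F x)).-integrable setT (fun t : R => t%:E).

Definition Mfun F (x y : R) : R :=
  \int[lebesgue_measure]_(t in `]-oo, y]) F x t.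

Definition icv_increasing I F : Prop :=
  forall x x', I x -> I x' -> x <= x' -> forall y, Mfun F x' y <= Mfun F x y.

(* P(|Y| >= y) for Y distributed according to [F x] *)
Definition abs_tail F (x y : R) : \bar R :=
  lebesgue_stieltjes_measure (F x) [set t : R | y <= `|t|].

End cdf_family.

Section estimator.
Context (R : realType) (n : nat) (x y : 'I_n -> R).

Definition distinct_values : seq R := sort <=%R (undup (codom x)).

Definition mult (v : R) : nat := #|[set j | x j == v]|.

Definition hmean (v z : R) : R :=
  (mult v)%:R^-1 * \sum_(j < n | x j == v) Num.max (z - y j) 0.

Local Notation xs := distinct_values.

Definition sq_loss (z : R) (eta : 'I_(size xs) -> R) : R :=
  \sum_(i < size xs) (mult xs`_i)%:R * (eta i - hmean xs`_i z) ^+ 2.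

Definition antitonic (eta : 'I_(size xs) -> R) : Prop :=
  forall i j : 'I_(size xs), (i <= j)%N -> eta j <= eta i.

Definition isotonic_lsq (z : R) (eta : 'I_(size xs) -> R) : Prop :=
  antitonic eta /\
  forall eta', antitonic eta' -> sq_loss z eta <= sq_loss z eta'.

Definition is_estimator (I : set R) (Mt : R -> R -> R) : Prop :=
  (forall z, isotonic_lsq z (fun i => Mt xs`_i z)) /\
  forall v, I v -> v \notin xs ->
    [/\ forall i, (i.+1 < size xs)%N -> xs`_i <= v < xs`_i.+1 ->
          forall z, Mt xs`_i.+1 z <= Mt v z <= Mt xs`_i z,
        (0 < size xs)%N -> v < xs`_0 -> forall z, Mt v z = Mt xs`_0 z &
        (0 < size xs)%N -> xs`_(size xs).-1 <= v ->
          forall z, Mt v z = Mt xs`_(size xs).-1 z].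

End estimator.

Section settings.
Context (R : realType).

(* [Discrete K] is the finite covariate setting with I = {1, ..., K};
   [Continuous L] is the setting of an interval I with covariate densities and
   Lipschitz constant L. *)
Inductive covariate_setting := Discrete of nat | Continuous of R.

Inductive tail_setting := PolynomialTail | ExponentialTail.

Definition covariate_condition d (Omega : measurableType d)
    (P : probability Omega R) (I : set R)
    (F : R -> cumulativeBounded (0 : R) (1 : R))
    (X : forall n, 'I_n -> {RV P >-> R}) (p : R) (c : covariate_setting) : Prop :=
  0 < p /\
  match c with
  | Discrete K =>
      [/\ (0 < K)%N,
          I = [set k%:R | k in [set k | (1 <= k <= K)%N]] &
          forall n (i : 'I_n),
            \big[mine/+oo%E]_(1 <= j < K.+1) P (X n i @^-1` [set j%:R]) = p%:E]
  | Continuous L =>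
      [/\ is_interval I,
          forall n (i : 'I_n), exists f : R -> R,
            [/\ measurable_fun setT f,
                forall t, 0 <= f t,
                forall B, measurable B -> distribution P (X n i) B =
                  (\int[lebesgue_measure]_(t in B) (f t)%:E)%E &
                forall t, I t -> p <= f t],
          0 < L &
          forall u v y, I u -> I v ->
            `|Mfun F u y - Mfun F v y| <= L * `|u - v|]
  end.

(* In the polynomial case [0 < y] excludes y = 0, where y^-lambda is read as
   +oo, whereas the library sets 0 `^ a = 0 for a != 0. *)
Definition tail_condition (I : set R)
    (F : R -> cumulativeBounded (0 : R) (1 : R)) (lambda : R)
    (t : tail_setting) : Prop :=
  match t with
  | PolynomialTail => 2 < lambda /\ exists2 y0, 0 <= y0 &
      forall y x, y0 <= y -> 0 < y -> I x ->
        (abs_tail F x y <= (y `^ (- lambda))%:E)%E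
  | ExponentialTail => 0 < lambda /\ exists2 y0, 0 <= y0 &
      forall y x, y0 <= y -> I x ->
        (abs_tail F x y <= (expR (- (lambda * y)))%:E)%E
  end.

Definition c_seq (p lambda : R) (c : covariate_setting) (t : tail_setting)
    (n : nat) : R :=
  match c, t with
  | Discrete _, PolynomialTail =>
      4 * p `^ (- (1 / 2)) * n%:R `^ (- (1 / 2) + 1 / lambda)
        * ln n%:R `^ (1 / 2 + 1 / lambda)
  | Discrete _, ExponentialTail =>
      8 * p `^ (- (1 / 2)) * lambda^-1 * n%:R `^ (- (1 / 2))
        * ln n%:R `^ (3 / 2)
  | Continuous L, PolynomialTail =>
      (4 * p `^ (- (1 / 2)) + L) * n%:R `^ (- (1 / 3) + 2 / (3 * lambda))
        * ln n%:R `^ (1 / 3 + 2 / (3 * lambda))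
  | Continuous L, ExponentialTail =>
      (2 / lambda) `^ (2 / 3) * (4 * p `^ (- (1 / 2)) + L)
        * n%:R `^ (- (1 / 3)) * ln n%:R
  end.

Definition boundary_width (lambda : R) (t : tail_setting) (n : nat) : R :=
  match t with
  | PolynomialTail => n%:R `^ (- (1 / 3) + 2 / (3 * lambda))
                        * ln n%:R `^ (1 / 3 + 2 / (3 * lambda))
  | ExponentialTail => (2 / lambda) `^ (2 / 3) * n%:R `^ (- (1 / 3)) * ln n%:R
  end.

Definition I_seq (I : set R) (lambda : R) (c : covariate_setting)
    (t : tail_setting) (n : nat) : set R :=
  match c with
  | Discrete K => [set k%:R | k in [set k | (1 <= k <= K)%N]]
  | Continuous _ => [set x | [/\ I x, I (x - boundary_width lambda t n) &
                                 I (x + boundary_width lambda t n)]]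
  end.

End settings.

(* Main.v *)
Require Import Defs.
From HB Require Import structures.
From mathcomp Require Import all_boot all_order all_algebra.
From mathcomp Require Import all_classical all_reals all_analysis.
From mathcomp Require Import measurable_realfun ring lra zify.
Import Order.TTheory GRing.Theory Num.Theory.
Import numFieldNormedType.Exports.

Set Implicit Arguments.
Unset Strict Implicit.
Unset Printing Implicit Defensive.

Local Open Scope classical_set_scope.
Local Open Scope ring_scope.

(* A level set perturbation of the least squares problem shows that the fit at a
   sample point is at most the average of (y - Y)_+ over some range of covariates
   that starts at any prescribed point to the left and ends to the right of it,
   and symmetrically from below. Such a range contains a window of length delta
   next to the point, hence at least N observations with high probability, and by
   monotonicity and the Lipschitz property the mean of its average differs from
   M_x(y) by at most L delta in the relevant direction.
   It remains to control the noise of all averages over ranges with at least N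
   observations, uniformly in y. Truncating the responses at B and rounding them
   to a grid of n + 1 points, they take finitely many values and, given the
   covariates, are distributed according to a finite product distribution, for
   which Hoeffding's inequality and a union bound over n^2 (n + 1) events suffice.
   The constants are those for which N t^2 = 8 B^2 ln n, where t is the noise
   term in c_n: the union bound is then of order n^3 exp(- 4 (1 - eps) ln n). *)

(** * Hoeffding's inequality on finite product spaces *)

Section hoeffding.
Context {R : realType}.
Implicit Types (th h : R).

(** The conditional law of the responses is given only through versions of conditional probabilities
    of single events, so there is no conditional measure to which a concentration inequality could
    be applied. With finitely many cells, the versions at each outcome are the weights of a product
    distribution on cell vectors, and the inequality becomes a statement about finite sums. The
    range over which the noise is averaged is random, but it is a function of the covariates and
    hence a constant under the conditioning. Both tail conditions enter through a single
    inverse-square envelope [tau * B ^+ 2 / s ^+ 2] for [s >= B], which contributes only multiples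
    of [tau * B] to the integrated distribution functions. Both covariate settings are instances of
    one bound in the window length [delta], the bias [Ld] and the count [N]: atoms have [delta = 0],
    [Ld = 0] and [N = n p / 2]; densities have [N = n p delta / 2], and [n delta^3 = B^2 ln n] makes
    the noise [4 p^(-1/2) delta] and the bias [L delta] of the same order. *)

Lemma bernoulli_mgf_pos th h : 0 <= th <= 1 -> 0 < 1 - th + th * expR h.
Proof.
move=> /andP[t0 t1]; have := expR_gt0 h => e0.
have [->|tn0] := eqVneq th 0; first by rewrite mul0r; lra.
have : 0 < th * expR h by rewrite mulr_gt0// lt_neqAle eq_sym tn0.
lra.
Qed.

Lemma is_derive_bernoulli_mgf th h :
  is_derive h 1 (fun x : R => 1 - th + th * expR x) (th * expR h).
Proof.
have : is_derive h 1 (fun x : R => 1 - th + th * expR x)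
  (0 + (th *: expR h : R)).
  by apply: is_deriveD.
by rewrite add0r.
Qed.

(** The quotient is the mean of the Bernoulli law [th] tilted by [expR h]. Its derivative in [h] is
    the variance of the tilted law, hence at most 1/4, and its value at 0 is [th]. *)
Lemma tilted_mean_lipschitz th h : 0 <= th <= 1 -> 0 <= h ->
  th * expR h / (1 - th + th * expR h) - th <= h / 4.
Proof.
move=> t01 h0.
pose D (x : R) : R := 1 - th + th * expR x.
pose v (x : R) : R := th * expR x * (D x)^-1.
pose dv (x : R) : R := th * expR x * (1 - th) * (D x ^+ 2)^-1.
have D0 x : 0 < D x by exact: bernoulli_mgf_pos.
have iv (x : R) : is_derive x 1 v (dv x).
  have dD := is_derive_bernoulli_mgf th x.
  have dN : is_derive x 1 (fun x : R => th * expR x) (th * expR x).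
    exact: (@is_deriveZ _ _ _ expR).
  have dI : is_derive x 1 (fun x => (D x)^-1) (- (D x) ^- 2 *: (th * expR x)).
    by apply: is_deriveV; rewrite gt_eqF.
  have dM := is_deriveM dN dI.
  apply: (@is_derive_eq _ _ _ _ _ _ _ _ dM).
  rewrite /dv /GRing.scale/=; have := D0 x; rewrite /D => Dx0.
  by field; rewrite gt_eqF.
have [c hc E] : exists2 c, c \in `[0, h]%R & v h - v 0 = dv c * (h - 0).
  apply: (@MVT_segment R v dv) => //.
  apply: derivable_within_continuous => x _.
  exact (@ex_derive _ _ _ _ _ _ _ (iv x)).
have v0 : v 0 = th by rewrite /v /D expR0 mulr1 subrK invr1 mulr1.
rewrite -/(D h) -/(v h) -[X in _ - X]v0 E subr0.
suff : dv c <= 1 / 4 by move=> ?; rewrite mulrC ler_wpM2l//; lra.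
rewrite /dv ler_pdivrMr ?exprn_gt0// /D.
have := sqr_ge0 (th * expR c - (1 - th)); nra.
Qed.

(** The logarithm of the left side minus the exponent on the right vanishes at 0 and has nonpositive
    derivative by the bound on the tilted mean; 1/8 comes from integrating the variance bound
    1/4. *)
Lemma bernoulli_mgf_le th h : 0 <= th <= 1 -> 0 <= h ->
  1 - th + th * expR h <= expR (th * h + h ^+ 2 / 8).
Proof.
move=> t01 h0.
pose D (x : R) : R := 1 - th + th * expR x.
have D0 x : 0 < D x by exact: bernoulli_mgf_pos.
pose g (x : R) : R := ln (D x) - (th * x + x ^+ 2 / 8).
pose dg (x : R) : R := th * expR x / D x - (th + x / 4).
have ig (x : R) : is_derive x 1 g (dg x).
  have dD : is_derive x 1 D _ := is_derive_bernoulli_mgf th x.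
  have dl : is_derive x 1 (@ln R \o D) (th * expR x * (D x)^-1).
    have dn := is_derive1_ln (D0 x).
    by rewrite mulrC; apply: is_derive1_comp.
  have d1 : is_derive x 1 (fun x : R => th * x + x ^+ 2 / 8) (th + x / 4).
    have d2 := is_deriveD (is_deriveZ th (is_derive_id x (1 : R)))
      (is_deriveZ 8^-1 (is_deriveM (is_derive_id x (1 : R)) (is_derive_id x 1))).
    have -> : (fun x : R => th * x + x ^+ 2 / 8) =
       (th *: id + 8^-1 *: (id * id) : R -> R).
      by apply/funext => z /=; rewrite !fctE /GRing.scale/= (mulrC 8^-1) expr2.
    apply: (@is_derive_eq _ _ _ _ _ _ _ _ d2).
    by rewrite /GRing.scale/=; field.
  have dB := is_deriveB dl d1.
  by apply: (@is_derive_eq _ _ _ _ _ _ _ _ dB); rewrite /dg /GRing.scale.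
have [c hc E] : exists2 c, c \in `[0, h]%R & g h - g 0 = dg c * (h - 0).
  apply: (@MVT_segment R g dg) => //.
  apply: derivable_within_continuous => x _.
  exact (@ex_derive _ _ _ _ _ _ _ (ig x)).
have g0 : g 0 = 0.
  by rewrite /g /D expR0 mulr1 subrK ln1 mulr0 expr0n/= mul0r addr0 subrr.
have : g h <= 0.
  move: E; rewrite g0 !subr0 => ->.
  rewrite mulr_le0_ge0//.
  have c0 : 0 <= c by move: hc; rewrite in_itv/= => /andP[].
  have := tilted_mean_lipschitz t01 c0; rewrite /dg -/(D c); lra.
rewrite /g subr_le0 -/(D h) -(ler_expR (ln _)) lnK//.
by rewrite posrE.
Qed.

(* Convexity reduces the claim to a two-point distribution on the endpoints
   of the range. *)
Lemma hoeffding_lemma (T : finType) (q f : T -> R) (a r s : R) :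
  (forall k, 0 <= q k) -> \sum_k q k = 1 ->
  (forall k, a <= f k <= a + r) -> 0 < r -> 0 <= s ->
  \sum_k q k * expR (s * (f k - \sum_j q j * f j))
    <= expR (s ^+ 2 * r ^+ 2 / 8).
Proof.
move=> q0 q1 fr r0 s0.
set m := \sum_j q j * f j.
pose th := (m - a) / r.
have ma : m - a = \sum_j q j * (f j - a).
  under [RHS]eq_bigr do rewrite mulrBr.
  by rewrite sumrB -mulr_suml q1 mul1r.
have th01 : 0 <= th <= 1.
  rewrite divr_ge0 ?(ltW r0)//=; last first.
    rewrite ma sumr_ge0// => j _; rewrite mulr_ge0// subr_ge0.
    by have /andP[] := fr j.
  rewrite ler_pdivrMr// mul1r ma.
  rewrite (_ : r = \sum_j q j * r); last by rewrite -mulr_suml q1 mul1r.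
  apply: ler_sum => j _; rewrite ler_wpM2l// lerBlDl.
  by have /andP[] := fr j.
have cvx k : expR (s * (f k - a)) <= 1 + (f k - a) / r * (expR (s * r) - 1).
  have [fa fb] := andP (fr k).
  set u := (f k - a) / r.
  have u01 : 0 <= u <= 1.
    by rewrite divr_ge0 ?subr_ge0 ?(ltW r0)//= ler_pdivrMr// mul1r lerBlDl.
  have -> : s * (f k - a) = u * (s * r).
    by rewrite /u; field; rewrite gt_eqF.
  have [u0 u1] := andP u01.
  have := @convex_expR R (Itv01 u0 u1) (s * r) 0.
  by rewrite !convRE/= mulr0 addr0 expR0 /unstable.onem; lra.
have -> : \sum_k q k * expR (s * (f k - m)) =
    expR (- (s * (m - a))) * \sum_k q k * expR (s * (f k - a)).
  rewrite mulr_sumr; apply: eq_bigr => k _.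
  by rewrite mulrCA -expRD; congr (_ * expR _); ring.
have le1 : \sum_k q k * expR (s * (f k - a)) <= 1 - th + th * expR (s * r).
  apply: (@le_trans _ _ (\sum_k q k * (1 + (f k - a) / r * (expR (s * r) - 1)))).
    by apply: ler_sum => k _; rewrite ler_wpM2l.
  under eq_bigr do rewrite mulrDr mulr1 !mulrA.
  rewrite big_split/= q1 -!mulr_suml -ma -/th; lra.
have sr0 : 0 <= s * r by rewrite mulr_ge0// ltW.
apply: (@le_trans _ _ (expR (- (s * (m - a))) * expR (th * (s * r) + (s * r) ^+ 2 / 8))).
  by rewrite ler_wpM2l ?expR_ge0// (le_trans le1)// bernoulli_mgf_le.
have r1 : r != 0 by rewrite gt_eqF.
rewrite -expRD ler_expR (_ : - _ + _ = s ^+ 2 * r ^+ 2 / 8)// /th.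
by field.
Qed.

(* The exponent [s] maximizing the Chernoff bound does not depend on [#|S|]. *)
Lemma hoeffding_upper (I T : finType) (q f : I -> T -> R) (S : {set I})
    (a r u : R) :
  (forall i k, 0 <= q i k) -> (forall i, \sum_k q i k = 1) ->
  (forall i k, a <= f i k <= a + r) -> 0 < r -> 0 <= u ->
  \sum_(k : {ffun I -> T} |
      #|S|%:R * u <= \sum_(i in S) (f i (k i) - \sum_j q i j * f i j))
    \prod_i q i (k i) <= expR (- (2 * #|S|%:R * u ^+ 2 / r ^+ 2)).
Proof.
move=> q0 q1 fr r0 u0.
pose s := 4 * u / r ^+ 2.
have s0 : 0 <= s by apply: divr_ge0; [apply: mulr_ge0|exact: sqr_ge0].
pose E i := \sum_j q i j * f i j.
pose G i k := q i k * (if i \in S then expR (s * (f i k - E i)) else 1).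
apply: (@le_trans _ _ (\sum_(k : {ffun I -> T})
   expR (- (s * (#|S|%:R * u))) * \prod_i G i (k i))).
  rewrite [leLHS]big_mkcond/=; apply: ler_sum => k _.
  have p0 : 0 <= \prod_i q i (k i) by apply: prodr_ge0.
  have -> : \prod_i G i (k i) = \prod_i q i (k i) *
      expR (s * \sum_(i in S) (f i (k i) - E i)).
    rewrite big_split/= mulr_sumr expR_sum; congr (_ * _).
    by rewrite [RHS]big_mkcond.
  rewrite mulrCA -expRD; case: ifPn => [H|_]; last by rewrite mulr_ge0 ?expR_ge0.
  rewrite ler_peMr// -[leLHS]expR0 ler_expR addrC subr_ge0 ler_wpM2l//.
rewrite -mulr_sumr -(bigA_distr_bigA G).
apply: (@le_trans _ _ (expR (- (s * (#|S|%:R * u))) *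
    expR (#|S|%:R * (s ^+ 2 * r ^+ 2 / 8)))).
  rewrite ler_wpM2l ?expR_ge0//.
  rewrite (_ : expR (_ * _) =
      \prod_i (if i \in S then expR (s ^+ 2 * r ^+ 2 / 8) else 1)); last first.
    by rewrite -big_mkcond/= prodr_const mulrC expRM_natr.
  apply: ler_prod => i _; apply/andP; split.
    by apply: sumr_ge0 => k _; rewrite /G; case: ifP; rewrite mulr_ge0 ?expR_ge0.
  rewrite /G; case: ifP => _.
    exact: (@hoeffding_lemma T (q i) (f i) a).
  by under eq_bigr do rewrite mulr1; rewrite q1.
have r1 : r != 0 by rewrite gt_eqF.
rewrite -expRD ler_expR (_ : - _ + _ = - (2 * #|S|%:R * u ^+ 2 / r ^+ 2))// /s.
by field.
Qed.

Lemma hoeffding_two_sided (I T : finType) (q f : I -> T -> R) (S : {set I})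
    (a r u : R) :
  (forall i k, 0 <= q i k) -> (forall i, \sum_k q i k = 1) ->
  (forall i k, a <= f i k <= a + r) -> 0 < r -> 0 <= u ->
  \sum_(k : {ffun I -> T} |
      #|S|%:R * u <= `|\sum_(i in S) (f i (k i) - \sum_j q i j * f i j)|)
    \prod_i q i (k i) <= 2 * expR (- (2 * #|S|%:R * u ^+ 2 / r ^+ 2)).
Proof.
move=> q0 q1 fr r0 u0.
have Hu := hoeffding_upper S q0 q1 fr r0 u0.
have fr' i k : - a - r <= - f i k <= - a - r + r by have := fr i k; lra.
have Hl := hoeffding_upper S q0 q1 fr' r0 u0.
rewrite [leRHS]mulr_natl [leRHS]mulr2n; apply: (le_trans _ (lerD Hu Hl)).
rewrite big_mkcond [X in _ <= X + _]big_mkcond [X in _ <= _ + X]big_mkcond.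
rewrite -big_split/=; apply: ler_sum => k _.
have p0 : 0 <= \prod_i q i (k i) by apply: prodr_ge0.
have -> : \sum_(i in S) (- f i (k i) - \sum_j q i j * - f i j) =
   - \sum_(i in S) (f i (k i) - \sum_j q i j * f i j).
  rewrite -sumrN; apply: eq_bigr => i _.
  under eq_bigr do rewrite mulrN.
  by rewrite sumrN; ring.
set z := \sum_(i in S) _.
have [zp|zn] := leP 0 z.
  by rewrite ger0_norm//; case: ifP; case: ifP => _ _; rewrite ?addr0 ?lerDl.
by rewrite ltr0_norm//; case: ifP; case: ifP => _ _; rewrite ?add0r ?addr0 ?lerDr.
Qed.
End hoeffding.

(** * Conditional independence *)

Section outer_union.
Local Open Scope ereal_scope.
Context d (T : measurableType d) (R : realType).

Lemma mu_ext_bigcup_le (mu : {measure set T -> \bar R}) (J : finType)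
    (A : J -> set T) (E : set T) :
  E `<=` \bigcup_j A j -> mu_ext mu E <= \sum_j mu_ext mu (A j).
Proof.
move=> EA.
have H (s : seq J) : mu_ext mu (\big[setU/set0]_(j <- s) A j) <=
    \sum_(j <- s) mu_ext mu (A j).
  elim: s => [|j s ih]; first by rewrite !big_nil mu_ext0.
  rewrite !big_cons; apply: (le_trans (outer_measureU2 _ _ _)).
  by rewrite leeD2l.
apply: le_trans (H (index_enum J)).
apply: le_mu_ext => w /EA[j _ Aj].
by rewrite -bigcup_seq; exists j => //=; exact: mem_index_enum.
Qed.

End outer_union.

Section conditional.
Context d (Omega : measurableType d) (R : realType) (P : probability Omega R).

Section sub_sigma_algebra.
Context (C : set (set Omega)).
Hypothesis Cm : C `<=` measurable.
Let G := <<s C>>.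
Let TG := g_sigma_algebraType C.

Lemma sub_sigma_measurable (A : set Omega) : G A -> measurable A.
Proof. by move=> GA; apply: GA; split => //; exact: sigma_algebra_measurable. Qed.

Lemma is_cond_prob_measurable E (g : Omega -> R) : is_cond_prob P G E g ->
  measurable_fun setT (g : TG -> R).
Proof. by case=> Gg _ _ _ B mB; rewrite setTI; exact: Gg. Qed.

(** Serves the extreme sublevel sets [set0] and [setT], about which the model says nothing
    directly. *)
Lemma is_cond_prob_cst (E : set Omega) (b : R) :
  (forall A, P (A `&` E) = b%:E * P A)%E -> is_cond_prob P G E (cst b).
Proof.
move=> Eb; split.
- move=> B _; rewrite preimage_cst; case: ifP => _.
    exact: (@measurableT _ TG).
  exact: (@measurable0 _ TG).
- exact: finite_measure_integrable_cst.
- move=> A GA; rewrite Eb.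
  by have := @integral_cst _ _ _ P A (sub_sigma_measurable GA) b%:E => <-.
Qed.

(** The model prescribes conditional probabilities of half-lines only; those of the cells are
    differences. *)
Lemma is_cond_probB (E1 E2 : set Omega) (g1 g2 : Omega -> R) :
  measurable E1 -> measurable E2 -> E1 `<=` E2 ->
  is_cond_prob P G E1 g1 -> is_cond_prob P G E2 g2 ->
  is_cond_prob P G (E2 `\` E1) (fun w => g2 w - g1 w).
Proof.
move=> m1 m2 E12 c1 c2.
have M1 := is_cond_prob_measurable c1; have M2 := is_cond_prob_measurable c2.
have [_ i1 h1] := c1; have [_ i2 h2] := c2; split.
- move=> B mB; have := measurable_funB M2 M1 (@measurableT _ TG) mB.
  by rewrite setTI.
- exact: (integrableB measurableT i2 i1).
- move=> A GA; have mA := sub_sigma_measurable GA.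
  under eq_integral do rewrite EFinB.
  rewrite integralB//; last 2 first.
  + exact: (integrableS measurableT mA (@subsetT _ _) i2).
  + exact: (integrableS measurableT mA (@subsetT _ _) i1).
  rewrite h1// h2//.
  have -> : A `&` (E2 `\` E1) = (A `&` E2) `\` (A `&` E1).
    by apply/seteqP; split => w /=; tauto.
  rewrite measureD; [|exact: measurableI..|]; last first.
    by rewrite (le_lt_trans (probability_le1 _ _)) ?ltry//; exact: measurableI.
  congr (_ - P _)%E; apply/seteqP; split => w; last by move=> [].
  by move=> [aw e1]; split => //; split => //; exact: E12.
Qed.

End sub_sigma_algebra.

(* Conditionally on the sigma-algebra [G], the vector of cells hit by the
   responses has a product distribution, so that the bound on conditional
   probabilities is a statement about finite product distributions. *)
Lemma conditional_cover_bound (C : set (set Omega)) (n : nat) (T : finType)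
    (Y : 'I_n -> {RV P >-> R}) (J : T -> set R) (q : 'I_n -> T -> Omega -> R)
    (A : {ffun 'I_n -> T} -> set Omega) (E : set Omega) (b : R) :
  C `<=` measurable ->
  cond_independent <<s C>> Y ->
  (forall k, measurable (J k)) ->
  (forall i k, is_cond_prob P <<s C>> (Y i @^-1` J k) (q i k)) ->
  (forall i k w, 0 <= q i k w) ->
  (forall k, <<s C>> (A k)) ->
  E `<=` \bigcup_k (A k `&` \bigcap_i (Y i @^-1` J (k i))) ->
  (forall w, \sum_(k | w \in A k) \prod_i q i (k i) w <= b) ->
  (mu_ext P E <= b%:E)%E.
Proof.
move=> Cm ci mJ cq q0 GA EA Hb.
have mA k : measurable (A k) by exact: (sub_sigma_measurable Cm).
have mYJ k : measurable (\bigcap_i (Y i @^-1` J (k i))).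
  apply: fin_bigcap_measurable => // i _.
  by rewrite -[X in measurable X]setTI; exact: measurable_funPT.
have cp k := ci (fun i => J (k i)) (fun i => q i (k i)) (fun i => mJ _) (fun i => cq _ _).
apply: (le_trans (mu_ext_bigcup_le P EA)).
pose g (k : {ffun 'I_n -> T}) w : \bar R := ((\prod_i q i (k i) w) * \1_(A k) w)%:E.
have mg k : measurable_fun setT (g k).
  apply/measurable_EFinP; apply: measurable_funM; last exact: measurable_indic.
  apply: measurable_prod => i _.
  by have [_ /integrableP[/measurable_EFinP]] := cq i (k i).
have g0 k w : (0 <= g k w)%E.
  by rewrite lee_fin mulr_ge0// prodr_ge0.
(* Since [A k] belongs to the conditioning sigma-algebra, the defining identity of conditional
   probabilities can be integrated over it. *)
have Eg k : mu_ext P (A k `&` \bigcap_i (Y i @^-1` J (k i))) = (\int[P]_w g k w)%E.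
  rewrite measurable_mu_extE; last exact: measurableI.
  have [_ _ h] := cp k; rewrite -[LHS]h// integral_mkcond; apply: eq_integral => w _.
  rewrite patchE /g indicE; case: ifPn => wA; first by rewrite mulr1.
  by rewrite mulr0.
rewrite (eq_bigr _ (fun k _ => Eg k)) -ge0_integral_sum//.
apply: (@le_trans _ _ (\int[P]_w (cst b%:E) w)%E).
  apply: ge0_le_integral => //.
  - by move=> w _; apply: sume_ge0.
  - exact: emeasurable_sum.
  - move=> w _; rewrite /g sumEFin lee_fin; apply: le_trans (Hb w).
    rewrite [leRHS]big_mkcond/=; apply: ler_sum => k _.
    by rewrite indicE; case: ifPn; rewrite ?mulr1 ?mulr0.
by rewrite integral_cst// [X in (_ * X)%E](@probability_setT _ _ _ P) mule1.
Qed.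

End conditional.

(** * Integrated distribution functions *)

Section inverse_square.
Context {R : realType}.
Local Notation mu := (@lebesgue_measure R).

Lemma continuous_inverse_square (x : R) : x != 0 ->
  {for x, continuous (fun t : R => (t ^+ 2)^-1)}.
Proof.
move=> x0; apply: cvgV; first by rewrite expf_neq0.
exact: exprn_continuous.
Qed.

Lemma within_continuous_inverse_square (B : R) : 0 < B ->
  {within `]-oo, - B], continuous (fun t : R => (t ^+ 2)^-1)}.
Proof.
move=> B0; apply/continuous_within_itvNycP; split.
  move=> x; rewrite in_itv/= => xB; apply: continuous_inverse_square.
  by rewrite lt_eqF// (lt_trans xB)// oppr_lt0.
by apply: cvg_at_left_filter; apply: continuous_inverse_square; rewrite oppr_eq0 gt_eqF.
Qed.

Lemma measurable_inverse_square (B : R) : 0 < B ->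
  measurable_fun `]-oo, - B] (fun t : R => (t ^+ 2)^-1).
Proof.
move=> B0; apply: subspace_continuous_measurable_fun => //.
exact: within_continuous_inverse_square.
Qed.

Lemma is_derive_opp_inv (x : R) : x != 0 ->
  is_derive x 1 (fun t : R => - t^-1) (x ^+ 2)^-1.
Proof.
move=> x0; have dV := is_deriveV x0 (is_derive_id x (1 : R)).
have dN := is_deriveN dV.
apply: (@is_derive_eq _ _ _ _ _ _ _ _ dN).
by rewrite /GRing.scale/= mulr1 opprK.
Qed.

Lemma integral_inverse_square (B : R) : 0 < B ->
  (\int[mu]_(t in `[B, +oo[) ((t ^+ 2)^-1)%:E = (B^-1)%:E)%E.
Proof.
move=> B0.
have cV (x : R) : 0 < x -> {for x, continuous (fun t : R => - t^-1)}.
  move=> x0; apply: cvgN; apply: cvgV; [by rewrite gt_eqF|exact: cvg_id].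
have cf (x : R) : 0 < x -> {for x, continuous (fun t : R => (t ^+ 2)^-1)}.
  by move=> x0; apply: continuous_inverse_square; rewrite gt_eqF.
rewrite (@ge0_continuous_FTC2y R (fun t => (t ^+ 2)^-1) (fun t => - t^-1) B 0).
- by rewrite sub0e -EFinN opprK.
- by move=> x _; rewrite invr_ge0 sqr_ge0.
- apply/continuous_within_itvcyP; split.
    by move=> x; rewrite in_itv/= andbT => Bx; apply: cf; exact: lt_trans Bx.
  by apply: cvg_at_right_filter; exact: cf.
- rewrite -[X in _ --> X]oppr0; apply: cvgN.
  by apply/gtr0_cvgV0; [exact: nbhs_pinfty_gt|exact: cvg_id].
- move=> x Bx; have x0 : x != 0 by rewrite gt_eqF// (lt_trans B0).
  exact: (@ex_derive _ _ _ _ _ _ _ (is_derive_opp_inv x0)).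
- by apply: cvg_at_right_filter; exact: cV.
- move=> x; rewrite in_itv/= andbT => Bx.
  have x0 : x != 0 by rewrite gt_eqF// (lt_trans B0).
  by rewrite derive1E; have := is_derive_opp_inv x0 => /(@derive_val _ _ _ _ _ _ _) ->.
Qed.

Lemma integral_inverse_squareN (B : R) : 0 < B ->
  (\int[mu]_(t in `]-oo, (- B)%R]) ((t ^+ 2)^-1)%:E = (B^-1)%:E)%E.
Proof.
move=> B0; rewrite ge0_integration_by_substitutionNy.
- rewrite -integral_inverse_square//; apply: eq_integral => x _ /=.
  by rewrite sqrrN.
- exact: within_continuous_inverse_square.
- by move=> x _; rewrite invr_ge0 sqr_ge0.
Qed.

End inverse_square.

Lemma lebesgue_measure_oc_lty {R : realType} (a b : R) :
  (@lebesgue_measure R `]a, b] < +oo)%E.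
Proof. by rewrite lebesgue_measure_itv/=; case: ifP; rewrite ?ltry// -EFinB ltry. Qed.

Section cdf_integral.
Context {R : realType} (F : R -> cumulativeBounded (0 : R) (1 : R)).
Local Notation mu := (@lebesgue_measure R).

Lemma cdf_ge0 x y : 0 <= F x y.
Proof. by rewrite -lee_fin -cdf_lebesgue_stieltjes_id; exact: measure_ge0. Qed.

Lemma cdf_le1 x y : F x y <= 1.
Proof. by rewrite -lee_fin -cdf_lebesgue_stieltjes_id; exact: probability_le1. Qed.

Lemma cdf_ndecr x : {homo F x : y z / y <= z}.
Proof. exact: (cumulative_is_nondecreasing (F x)). Qed.

Lemma measurable_cdf x (D : set R) : measurable D -> measurable_fun D (F x).
Proof. by move=> mD; apply: nondecreasing_measurable => // y z; exact: cdf_ndecr. Qed.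

Let lsm x := lebesgue_stieltjes_measure (F x).

Lemma lsm_itvNy x y : lsm x `]-oo, y] = (F x y)%:E.
Proof. by rewrite -cdf_lebesgue_stieltjes_id /cdf /= /pushforward preimage_id. Qed.

Lemma measurable_abs_ge (s : R) : measurable [set t : R | s <= `|t|].
Proof.
rewrite (_ : [set t | _] = `]-oo, - s]%classic `|` `[s, +oo[%classic).
  exact: measurableU.
apply/seteqP; split => t /=; rewrite !in_itv/= andbT ler_normr lerNr orbC => /orP//.
Qed.

Lemma cdf_abs_tailN x s : ((F x (- s))%:E <= abs_tail F x s)%E.
Proof.
rewrite -lsm_itvNy /abs_tail; apply: le_measure; rewrite ?inE//.
  exact: measurable_abs_ge.
move=> t /=; rewrite in_itv/= => ts.
by rewrite -normrN (le_trans _ (ler_norm _))// lerNr.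
Qed.

Lemma cdf_abs_tail x s : ((1 - F x s)%:E <= abs_tail F x s)%E.
Proof.
rewrite EFinB -lsm_itvNy -probability_setC// /abs_tail; apply: le_measure; rewrite ?inE//.
- exact: measurableC.
- exact: measurable_abs_ge.
- move=> t /=; rewrite in_itv/= => /negP; rewrite -ltNge => /ltW ts.
  exact: le_trans (ler_norm _).
Qed.

Variables (B tau : R) (x : R).
Hypotheses (B0 : 0 < B) (tau0 : 0 <= tau).
Hypothesis tailN : forall s, B <= s -> F x (- s) <= tau * B ^+ 2 / s ^+ 2.
Hypothesis tailP : forall s, B <= s -> 1 - F x s <= tau * B ^+ 2 / s ^+ 2.

Lemma integral_cdf_left : (\int[mu]_(t in `]-oo, (- B)%R]) (F x t)%:E <= (tau * B)%:E)%E.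
Proof.
apply: (@le_trans _ _ (\int[mu]_(t in `]-oo, (- B)%R])
  ((tau * B ^+ 2)%:E * ((t ^+ 2)^-1)%:E))%E).
  apply: ge0_le_integral => //.
  - by move=> t _; rewrite lee_fin cdf_ge0.
  - by apply/measurable_EFinP; exact: measurable_cdf.
  - apply/measurable_EFinP; apply: measurable_funM => //.
    exact: measurable_inverse_square.
  - move=> t /=; rewrite in_itv/= => tB; rewrite -EFinM lee_fin.
    by rewrite -[t]opprK sqrrN; apply: tailN; rewrite lerNr.
rewrite ge0_integralZl//.
- rewrite integral_inverse_squareN// -EFinM lee_fin.
  by rewrite -mulrA expr2 mulfK// gt_eqF.
- by apply/measurable_EFinP; exact: measurable_inverse_square.
- by move=> t _; rewrite lee_fin invr_ge0 sqr_ge0.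
- by rewrite lee_fin mulr_ge0// sqr_ge0.
Qed.

(** [Mfun] is a real-valued integral, which is 0 by default when the extended one is infinite, so it
    can be compared and subtracted only after integrability is known. *)
Lemma integrable_cdf y : mu.-integrable `]-oo, y] (EFin \o F x).
Proof.
have iN : mu.-integrable `]-oo, (- B)] (EFin \o F x).
  apply/integrableP; split; first by apply/measurable_EFinP; exact: measurable_cdf.
  under eq_integral do rewrite gee0_abs ?lee_fin ?cdf_ge0//.
  by rewrite (le_lt_trans integral_cdf_left)// ltry.
have [yB|By] := leP y (- B).
  by apply: integrableS iN => //; apply: subset_itvl; rewrite bnd_simp.
have iB : mu.-integrable `](- B), y] (EFin \o F x).
  apply: measurable_bounded_integrable => //.
  - exact: lebesgue_measure_oc_lty.
  - exact: measurable_cdf.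
  - exists 1; split; first exact: num_real.
    move=> M M1 t _; rewrite /= ger0_norm ?cdf_ge0//.
    exact: le_trans (cdf_le1 _ _) (ltW M1).
have mF : measurable_fun `]-oo, y] (EFin \o F x).
  by apply/measurable_EFinP; exact: measurable_cdf.
apply/integrableP; split => //.
have yU : `]-oo, y]%classic = `]-oo, (- B)]%classic `|` `](- B), y]%classic.
  by rewrite -itv_bndbnd_setU// bnd_simp ltW.
rewrite yU ge0_integral_setU//.
- have /integrableP[_ h1] := iN; have /integrableP[_ h2] := iB.
  by rewrite lte_add_pinfty.
- by rewrite -yU; exact: measurableT_comp.
- apply/disj_set2P/seteqP; split => t //= [].
  by rewrite !in_itv/= => tB /andP[Bt _]; move: (lt_le_trans Bt tB); rewrite ltxx.
Qed.

Lemma Mfun_ge0 y : 0 <= Mfun F x y.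
Proof. by apply: Rintegral_ge0 => t _; exact: cdf_ge0. Qed.

Lemma Mfun_left : Mfun F x (- B) <= tau * B.
Proof.
rewrite -lee_fin /Mfun /Rintegral fineK ?integral_cdf_left//.
exact: integrable_fin_num (integrable_cdf _).
Qed.

Lemma Mfun_incr y z : y <= z ->
  (z - y) * F x y <= Mfun F x z - Mfun F x y <= (z - y) * F x z.
Proof.
move=> yz.
rewrite /Mfun Rintegral_itvB//; last exact: integrable_cdf.
have iyz : mu.-integrable `]y, z] (EFin \o F x).
  apply: integrableS (integrable_cdf z) => //.
  by apply: subset_itvr; rewrite bnd_simp.
have ic (k : R) : mu.-integrable `]y, z] (EFin \o (fun=> k)).
  apply: measurable_bounded_integrable => //; first exact: lebesgue_measure_oc_lty.
  exists `|k|; split; first exact: num_real.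
  by move=> M /ltW kM t _.
have mE : fine (mu `]y, z]%classic) = z - y.
  rewrite lebesgue_measure_itv/= lte_fin.
  by case: ltP => //= zy; rewrite (le_anti (introT andP (conj yz zy))) subrr.
apply/andP; split.
- rewrite mulrC -mE -Rintegral_cst//; apply: le_Rintegral => // t /=.
  by rewrite in_itv/= => /andP[/ltW yt _]; exact: cdf_ndecr.
- rewrite mulrC -mE -Rintegral_cst//; apply: le_Rintegral => // t /=.
  by rewrite in_itv/= => /andP[_ tz]; exact: cdf_ndecr.
Qed.

(** The deficit is the integral of [1 - F x] over []B, y]]. On a dyadic piece from [z] to [2 z] it
    is at most [z] times the tail at [z], that is [tau * B ^+ 2 / z]; this halves with each
    doubling, and the geometric series yields the factor 2. *)
Lemma Mfun_right y : B <= y -> y - B - 2 * (tau * B) <= Mfun F x y - Mfun F x B <= y - B.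
Proof.
move=> By; apply/andP; split; last first.
  have /andP[_ h] := Mfun_incr By; apply: (le_trans h).
  by rewrite ler_piMr ?subr_ge0// cdf_le1.
have step z y' : B <= z -> z <= y' -> y' <= 2 * z ->
    (y' - z) - (Mfun F x y' - Mfun F x z) <= tau * B ^+ 2 / z.
  move=> Bz zy y2.
  have /andP[h _] := Mfun_incr zy.
  have z0 : 0 < z by exact: lt_le_trans Bz.
  apply: (@le_trans _ _ (z * (tau * B ^+ 2 / z ^+ 2))).
    have := tailP Bz; have := cdf_le1 x z; nra.
  by rewrite le_eqVlt; apply/orP; left; apply/eqP; field; rewrite gt_eqF.
have [j hj] : exists j, y <= 2 ^+ j * B.
  exists (Num.truncn (y / B)).+1; rewrite -ler_pdivrMr//.
  apply: ltW; apply: (lt_le_trans (truncnS_gt _)).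
  by rewrite -natrX ler_nat ltnW// ltn_expl.
have key z : B <= z -> z <= y -> y <= 2 ^+ j * z ->
    (y - z) - (Mfun F x y - Mfun F x z) <= 2 * (tau * B ^+ 2 / z).
  move: hj => _; elim: j z => [|j ih] z Bz zy.
    rewrite expr0 mul1r => yz; have -> : y = z by apply/le_anti/andP.
    have z0 : 0 < z by exact: lt_le_trans Bz.
    by rewrite !subrr mulr_ge0// divr_ge0 ?(ltW z0)// mulr_ge0// sqr_ge0.
  rewrite exprS => yz.
  have z0 : 0 < z by exact: lt_le_trans Bz.
  have t0 : 0 <= tau * B ^+ 2 / z by rewrite divr_ge0 ?(ltW z0)// mulr_ge0// sqr_ge0.
  have [y2|y2] := leP y (2 * z).
    have := step _ _ Bz zy y2; lra.
  have z2 : z <= 2 * z by lra.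
  have h1 := step _ _ Bz z2 (lexx _).
  have h2 : y - 2 * z - (Mfun F x y - Mfun F x (2 * z)) <= 2 * (tau * B ^+ 2 / (2 * z)).
    by apply: ih; [lra|lra|rewrite mulrCA mulrA].
  have E : 2 * (tau * B ^+ 2 / (2 * z)) = tau * B ^+ 2 / z.
    by field; rewrite gt_eqF.
  by rewrite E in h2; lra.
have := key _ (lexx _) By hj.
have -> : tau * B ^+ 2 / B = tau * B by field; rewrite gt_eqF.
lra.
Qed.

End cdf_integral.

(** * Discretization of the responses *)

Section grid.
Context {R : realType} (F : R -> cumulativeBounded (0 : R) (1 : R)).
Variables (B : R) (m : nat).
Hypotheses (B0 : 0 < B) (m0 : (0 < m)%N).

Definition grid_step : R := 2 * B / m%:R.
Definition grid (l : nat) : R := - B + l%:R * grid_step.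

(* The cells are ]-oo, -B], the grid intervals, and ]B, +oo[. *)
Definition below_cell (k : nat) : set R :=
  if k is k'.+1 then (if (k' <= m)%N then `]-oo, grid k']%classic else setT) else set0.

Definition cell (k : nat) : set R := below_cell k.+1 `\` below_cell k.

Definition below_mass (x : R) (k : nat) : R :=
  if k is k'.+1 then (if (k' <= m)%N then F x (grid k') else 1) else 0.

Definition cell_mass (x : R) (k : nat) : R := below_mass x k.+1 - below_mass x k.

(** A response in cell [k] is rounded up to [grid k]. The [minn] rounds the unbounded last cell down
    to [B], so that all rounded responses lie in an interval of length [2 * B]. *)
Definition grid_loss (l k : nat) : R := Num.max (grid l - grid (minn k m)) 0.

Definition grid_mean (x : R) (l : nat) : R :=
  \sum_(k < m.+2) cell_mass x k * grid_loss l k.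

Lemma grid_step_gt0 : 0 < grid_step.
Proof. by rewrite divr_gt0 ?mulr_gt0 ?ltr0n. Qed.

Lemma grid_le (k l : nat) : (k <= l)%N -> grid k <= grid l.
Proof.
by move=> kl; rewrite lerD2l ler_wpM2r ?ler_nat// ltW// grid_step_gt0.
Qed.

Lemma gridS l : grid l.+1 = grid l + grid_step.
Proof. by rewrite /grid -natr1 mulrDl mul1r addrA. Qed.

Lemma grid0 : grid 0 = - B. Proof. by rewrite /grid mul0r addr0. Qed.

Lemma grid_last : grid m = B.
Proof.
have mn : m%:R != 0 :> R by rewrite pnatr_eq0 -lt0n.
by rewrite /grid /grid_step; field.
Qed.

Lemma below_mass_homo x k : below_mass x k <= below_mass x k.+1.
Proof.
case: k => [|k] /=; first exact: cdf_ge0.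
have [km|km] := leqP k.+1 m; first by rewrite (ltnW km) cdf_ndecr ?grid_le.
by case: ifP => // _; exact: cdf_le1.
Qed.

Lemma cell_mass_ge0 x k : 0 <= cell_mass x k.
Proof. by rewrite subr_ge0 below_mass_homo. Qed.

Lemma cell_mass_sum x l : \sum_(k < l) cell_mass x k = below_mass x l.
Proof.
elim: l => [|l ih]; first by rewrite big_ord0.
by rewrite big_ord_recr ih [LHS]addrC [LHS]subrK.
Qed.

Lemma cell_mass_total x : \sum_(k < m.+2) cell_mass x k = 1.
Proof. by rewrite cell_mass_sum /below_mass ltnn. Qed.

Lemma below_cell_homo k : below_cell k `<=` below_cell k.+1.
Proof.
case: k => [|k] //=; have [km|km] := leqP k.+1 m.
  by rewrite (ltnW km) => y /=; rewrite !in_itv/= => /le_trans; apply; exact: grid_le.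
by case: ifP.
Qed.

Lemma measurable_below_cell k : measurable (below_cell k).
Proof. by case: k => [|k] //=; case: ifP. Qed.

Lemma measurable_cell k : measurable (cell k).
Proof. by apply: measurableD; exact: measurable_below_cell. Qed.

Lemma in_inner_cell y : - B < y <= B ->
  exists2 k : 'I_m.+2, (0 < k <= m)%N & cell k y.
Proof.
move=> /andP[By yB].
have ex : exists l, y <= grid l by exists m; rewrite grid_last.
pose l := ex_minn ex.
have [yl lmin] : y <= grid l /\ forall j, y <= grid j -> (l <= j)%N.
  by rewrite /l; case: ex_minnP.
have lm : (l <= m)%N by apply: lmin; rewrite grid_last.
have l0 : (0 < l)%N.
  by rewrite lt0n; apply: contraTN By => /eqP l0; move: yl; rewrite l0 grid0 -leNgt.
exists (Ordinal (leq_trans lm (leqnSn _) : (l < m.+2)%N)); first by rewrite /= l0.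
split; rewrite /below_cell/= ?lm /= ?in_itv//=.
move: l0 lm lmin; case: (l) => // j _ jm lmin.
by rewrite (ltnW jm) /= in_itv/= => /lmin; rewrite ltnn.
Qed.

Lemma inner_cell_bounds y k : (0 < k <= m)%N -> cell k y ->
  grid k - grid_step <= y <= grid k.
Proof.
case: k => // k /= km; rewrite /cell /below_cell km (ltnW km) /= !in_itv/= => -[-> /negP].
by rewrite -ltNge gridS addrK andbT => /ltW.
Qed.

Lemma grid_loss_bounds l k : (l <= m)%N -> 0 <= grid_loss l k <= 0 + 2 * B.
Proof.
move=> lm; rewrite /grid_loss le_max lexx orbT/= add0r ge_max; apply/andP; split; last first.
  by rewrite mulr_ge0// ltW.
have := grid_le lm; have := grid_le (leq0n (minn k m)).
rewrite grid0 grid_last; lra.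
Qed.

Lemma grid_mean0 x : grid_mean x 0 = 0.
Proof.
rewrite /grid_mean big1// => k _; rewrite /grid_loss (_ : Num.max _ _ = 0) ?mulr0//.
by apply/max_idPr; rewrite subr_le0 grid_le.
Qed.

(** Raising the threshold by one step raises the loss by [grid_step] exactly on the cells up to [l],
    which have total mass [F x (grid l)]. Thus [grid_mean] is a left Riemann sum for [Mfun]. *)
Lemma grid_meanS x l : (l < m)%N ->
  grid_mean x l.+1 = grid_mean x l + grid_step * F x (grid l).
Proof.
move=> lm.
have -> : F x (grid l) = \sum_(k < m.+2) cell_mass x k * (k <= l)%:R.
  have lm2 : (l.+1 <= m.+2)%N by rewrite (leq_trans lm)// (leq_trans (leqnSn _)).
  under eq_bigr do rewrite mulr_natr mulrb.
  rewrite -big_mkcond/= -(big_ord_widen_cond _ xpredT (fun k => cell_mass x k) lm2).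
  by rewrite cell_mass_sum /below_mass (ltnW lm).
rewrite /grid_mean mulr_sumr -big_split/=; apply: eq_bigr => k _.
rewrite mulrCA -mulrDr; congr (_ * _); rewrite /grid_loss gridS.
have s0 := grid_step_gt0.
have [kl|lk] := leqP k l.
  have : grid (minn k m) <= grid l by apply: grid_le; rewrite (leq_trans (geq_minl _ _)).
  by move=> h; rewrite !(max_idPl _) ?subr_ge0 ?(le_trans h)// ?mulr1; lra.
have : grid l.+1 <= grid (minn k m) by apply: grid_le; rewrite leq_min lk.
by rewrite gridS => h; rewrite !(max_idPr _) ?mulr0 ?addr0//; lra.
Qed.

Variables (tau : R).
Hypothesis tau0 : 0 <= tau.

(** The factor [B ^+ 2] normalizes the envelope to [tau] at [s = B], so [tau] also bounds the mass
    cut off on either side. *)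
Definition tail_bounded (x : R) := forall s, B <= s ->
  F x (- s) <= tau * B ^+ 2 / s ^+ 2 /\ 1 - F x s <= tau * B ^+ 2 / s ^+ 2.

Lemma tail_bounded_Mfun_left x : tail_bounded x -> Mfun F x (- B) <= tau * B.
Proof. by move=> h; apply: Mfun_left => // s /h[]. Qed.

Lemma tail_bounded_Mfun_incr x y z : tail_bounded x -> y <= z ->
  (z - y) * F x y <= Mfun F x z - Mfun F x y <= (z - y) * F x z.
Proof. by move=> h; apply: (Mfun_incr B0 tau0) => s /h[]. Qed.

Lemma tail_bounded_Mfun_right x y : tail_bounded x -> B <= y ->
  y - B - 2 * (tau * B) <= Mfun F x y - Mfun F x B <= y - B.
Proof. by move=> h; apply: Mfun_right => // s /h[]. Qed.

Lemma grid_mean_approx x l : tail_bounded x -> (l <= m)%N ->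
  0 <= Mfun F x (grid l) - grid_mean x l <= tau * B + grid_step.
Proof.
move=> tx lm.
(* For a monotone integrand the errors of the Riemann sum telescope, so they add up to at most one
   [grid_step] rather than one per interval; [tau * B] is the integral to the left of the grid. *)
suff : 0 <= Mfun F x (grid l) - grid_mean x l <=
    tau * B + grid_step * (F x (grid l) - F x (grid 0)).
  move=> /andP[-> /= h]; apply: (le_trans h).
  have := cdf_le1 F x (grid l); have := cdf_ge0 F x (grid 0).
  have := grid_step_gt0; nra.
elim: l lm => [_|l ih lm].
  rewrite grid_mean0 subr0 grid0 subrr mulr0 addr0 Mfun_ge0/=.
  exact: tail_bounded_Mfun_left.
have := ih (ltnW lm); rewrite grid_meanS//.
have := tail_bounded_Mfun_incr tx (grid_le (leqnSn l)).
rewrite [X in X - grid l]gridS (addrC (grid l)) addrK.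
by move=> /andP[h1 h2] /andP[h3 h4]; apply/andP; split; lra.
Qed.

Lemma max_sub_le (a b c d : R) : a <= b -> d <= c ->
  0 <= Num.max (b - d) 0 - Num.max (a - c) 0 <= (b - a) + (c - d).
Proof.
move=> ab dc.
by case: (leP 0 (b - d)); case: (leP 0 (a - c)) => h1 h2; lra.
Qed.

(** The level [l] depends on [y] alone, so one choice serves all observations. Finitely many levels
    cover the whole line: left of [- B] the loss vanishes and the mean is at most [tau * B], and
    right of [B] both grow with slope 1, up to an error of [2 * (tau * B)]. *)
Lemma grid_approx (y : R) : exists l : 'I_m.+1,
  forall x z k, tail_bounded x -> (0 < k <= m)%N -> cell k z ->
  `|(Num.max (y - z) 0 - Mfun F x y) - (grid_loss l k - grid_mean x l)|
    <= 2 * grid_step + 2 * (tau * B).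
Proof.
have s0 := grid_step_gt0.
have tB0 : 0 <= tau * B by rewrite mulr_ge0// ltW.
have kk k : (0 < k <= m)%N -> minn k m = k by move=> /andP[_ /minn_idPl].
have [yB|By] := ltP y (- B).
  exists ord0 => x z k tx km cz.
  have /andP[zl zr] := inner_cell_bounds km cz.
  have zB : - B <= z.
    apply: le_trans zl; move: km => /andP[]; case: k {cz zr} => // k _ _.
    by rewrite gridS addrK -grid0 grid_le.
  have -> : Num.max (y - z) 0 = 0 by apply/max_idPr; lra.
  have -> : grid_loss (@ord0 m) k = 0.
    by apply/max_idPr; rewrite subr_le0 grid_le.
  rewrite grid_mean0 !subr0 sub0r normrN ger0_norm ?Mfun_ge0//.
  have h1 := tail_bounded_Mfun_left tx.
  have /andP[h2 _] := tail_bounded_Mfun_incr tx (ltW yB).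
  have h3 : 0 <= (- B - y) * F x y by rewrite mulr_ge0 ?cdf_ge0//; lra.
  lra.
have [yB|yB] := leP B y.
  exists ord_max => x z k tx km cz.
  have /andP[zl zr] := inner_cell_bounds km cz.
  have /andP[h1 h2] := tail_bounded_Mfun_right tx yB.
  have := grid_mean_approx tx (leqnn m); rewrite grid_last => /andP[h3 h4].
  have kB : grid k <= B by rewrite -[leRHS]grid_last grid_le//; case/andP: km.
  rewrite /= /grid_loss kk// grid_last (max_idPl _); last lra.
  rewrite (max_idPl _); last lra.
  rewrite ler_norml; apply/andP; split; lra.
have yB0 : 0 <= (y + B) / grid_step by rewrite divr_ge0 ?(ltW s0)//; lra.
have /andP[lb ub] := truncn_itv yB0.
have ybm : (Num.truncn ((y + B) / grid_step) < m.+1)%N.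
  rewrite ltnS -(ler_nat R) (le_trans lb)// ler_pdivrMr//.
  by have := grid_last; rewrite /grid; lra.
exists (Ordinal ybm) => x z k tx km cz.
have {}lb : grid (Ordinal ybm) <= y.
  by rewrite /grid/= addrC -lerBrDr opprK -ler_pdivlMr.
have {}ub : y <= grid (Ordinal ybm) + grid_step.
  by rewrite -gridS /grid/= addrC -lerBlDr opprK -ler_pdivrMr// ltW.
set l := Ordinal ybm in lb ub *.
have /andP[zl zr] := inner_cell_bounds km cz.
have lm : (l <= m)%N := ybm.
have /andP[h3 h4] := grid_mean_approx tx lm.
have /andP[h1 h2] := tail_bounded_Mfun_incr tx lb.
have h5 : 0 <= (y - grid l) * F x (grid l) by rewrite mulr_ge0 ?cdf_ge0// subr_ge0.
have h6 : (y - grid l) * F x y <= y - grid l by rewrite ler_piMr ?cdf_le1// subr_ge0.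
have E : grid_loss l k = Num.max (grid l - grid k) 0 by rewrite /grid_loss kk.
have := max_sub_le lb zr; rewrite -E => /andP[h7 h8].
rewrite ler_norml; apply/andP; split; lra.
Qed.

End grid.

(** * Noise of the averaged responses *)

Lemma measurable_bool_set d (T : measurableType d) (b : T -> bool) :
  measurable_fun setT b -> measurable [set w | b w].
Proof. by move=> mb; rewrite -[X in measurable X]setTI; exact: mb. Qed.

Section noise.
Context d (Omega : measurableType d) (R : realType) (P : probability Omega R).
Context (I : set R) (F : R -> cumulativeBounded (0 : R) (1 : R)) (n : nat).
Context (X Y : 'I_n -> {RV P >-> R}).
Hypothesis XY : sampling_model I F X Y.
Hypothesis n0 : (0 < n)%N.
Variables (B tau : R).
Hypotheses (B0 : 0 < B) (tau0 : 0 <= tau).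
Hypothesis tail : forall x, I x -> tail_bounded F B tau x.

(** Written out as in [g_sigma_preimage], so that the clauses of [sampling_model] apply to [G] by
    conversion. *)
Let C : set (set Omega) :=
  \big[setU/set0]_(i < n) preimage_set_system setT (X i : Omega -> R) measurable.
Let G := <<s C>>.
Let TG := g_sigma_algebraType C.

Let Cm : C `<=` measurable.
Proof.
rewrite /C -bigcup_seq => A [i _ [D mD <-]].
exact: measurable_funPT.
Qed.

Let mX i : measurable_fun setT (X i : TG -> R).
Proof.
move=> _ D mD; apply: sub_sigma_algebra; rewrite /C -bigcup_seq.
by exists i => /=; [exact: mem_index_enum|exists D].
Qed.

Let XI i w : I (X i w). Proof. by case: XY => _ + _ _; exact. Qed.

Let below_cond_prob i k :
  is_cond_prob P G (Y i @^-1` below_cell B n k) (fun w => below_mass F B n (X i w) k).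
Proof.
case: k => [|k] /=.
  apply: is_cond_prob_cst => // A.
  by rewrite preimage_set0 setI0 measure0 mul0e.
case: ifP => _; first by case: XY.
apply: is_cond_prob_cst => // A.
by rewrite preimage_setT setIT mul1e.
Qed.

Let cell_cond_prob i k :
  is_cond_prob P G (Y i @^-1` cell B n k) (fun w => cell_mass F B n (X i w) k).
Proof.
have mb j : measurable (Y i @^-1` below_cell B n j).
  by apply: measurable_funPTI; exact: measurable_below_cell.
apply: (is_cond_probB Cm (mb k) (mb k.+1) _ (below_cond_prob i k) (below_cond_prob i k.+1)).
by apply: preimage_subset; exact: below_cell_homo.
Qed.

Lemma cell_prob_le i k (b : R) : (forall w, cell_mass F B n (X i w) k <= b) ->
  (mu_ext P (Y i @^-1` cell B n k) <= b%:E)%E.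
Proof.
move=> kb; have [_ ig hg] := cell_cond_prob i k.
rewrite measurable_mu_extE; last first.
  by apply: measurable_funPTI; exact: measurable_cell.
have hT := hg setT (@measurableT _ TG); rewrite setTI in hT; rewrite -[leLHS]hT.
apply: (@le_trans _ _ (\int[P]_w (cst b%:E) w)%E).
  apply: ge0_le_integral => //.
  - by move=> w _; rewrite lee_fin cell_mass_ge0.
  - by case/integrableP : ig.
  - by move=> w _; rewrite lee_fin kb.
by rewrite integral_cst// [X in (_ * X)%E](@probability_setT _ _ _ P) mule1.
Qed.

Lemma outer_cells_prob :
  (mu_ext P [set w | exists i, ~~ (- B < Y i w <= B)%R] <= (2 * n%:R * tau)%:E)%E.
Proof.
pose A (z : 'I_n * bool) := Y z.1 @^-1` cell B n (if z.2 then 0 else n.+1)%N.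
apply: (@le_trans _ _ (\sum_(z : 'I_n * bool) mu_ext P (A z))%E).
  apply: mu_ext_bigcup_le => w /= [i]; rewrite negb_and -!leNgt -ltNge => /orP[Yi|Yi].
    exists (i, true) => //; rewrite /A /= /cell; split => //=.
    by rewrite in_itv/= grid0.
  exists (i, false) => //; rewrite /A /= /cell /below_cell ltnn leqnn; split => //=.
  by rewrite in_itv/= grid_last//; apply/negP; rewrite -ltNge.
apply: (@le_trans _ _ (\sum_(z : 'I_n * bool) tau%:E)%E).
  apply: lee_sum => -[i b] _; apply: cell_prob_le => w.
  have [h1 h2] := tail (XI i w) (lexx B).
  (* The envelope at [s = B] bounds the mass of either outer cell, and there are [2 n] pairs of a
     response and a side. *)
  have E : tau * B ^+ 2 / B ^+ 2 = tau by rewrite mulfK// expf_neq0// gt_eqF.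
  case: b; rewrite /cell_mass /below_mass /=.
    by rewrite subr0 grid0 (le_trans h1)// E.
  by rewrite ltnn leqnn grid_last// (le_trans h2)// E.
rewrite sumEFin sumr_const card_prod card_ord card_bool lee_fin.
by rewrite -[leLHS]mulr_natl natrM (mulrC n%:R).
Qed.

(** The endpoints are observed covariates, so there are [n ^ 2] ranges for each outcome, each
    determined by the covariates alone. *)
Definition sample_range (a b : 'I_n) (w : Omega) : {set 'I_n} :=
  [set i | X a w <= X i w <= X b w].

Let measurable_sample_range a b S :
  measurable ([set w | sample_range a b w = S] : set TG).
Proof.
rewrite (_ : [set w | _] =
   \bigcap_(i : 'I_n) [set w | (X a w <= X i w <= X b w) = (i \in S)]).
  apply: fin_bigcap_measurable => // i _.
  have mb := measurable_bool_set (measurable_and (measurable_fun_ler (mX a) (mX i))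
    (measurable_fun_ler (mX i) (mX b))).
  case: (i \in S).
    by rewrite (_ : [set w | _] = [set w | X a w <= X i w <= X b w]).
  rewrite (_ : [set w | _] = ~` [set w | X a w <= X i w <= X b w]).
    exact: (@measurableC _ TG).
  by apply/seteqP; split => w /= => [->//|/negP/negbTE].
apply/seteqP; split => w /=.
  by move=> <- i _; rewrite /= inE.
by move=> h; apply/setP => i; rewrite inE (h i).
Qed.

(** The cell vector [k] is a parameter here, not the random one, which leaves a function measurable
    with respect to the covariates. *)
Definition cell_noise (l : nat) (k : {ffun 'I_n -> 'I_n.+2}) (i : 'I_n) (w : Omega) : R :=
  grid_loss B n l (k i) - grid_mean F B n (X i w) l.

Let measurable_cell_noise l k i : measurable_fun setT (cell_noise l k i : TG -> R).
Proof.
apply: measurable_funB => //; apply: measurable_sum => j.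
apply: measurable_funM => //.
exact: (is_cond_prob_measurable (cell_cond_prob i j)).
Qed.

Lemma sample_range_noise_prob (a b : 'I_n) (l : 'I_n.+1) (N u : R) : 0 <= u ->
  (mu_ext P [set w | exists k : {ffun 'I_n -> 'I_n.+2},
      (forall i, cell B n (k i) (Y i w)) /\
      ((N <= #|sample_range a b w|%:R /\ #|sample_range a b w|%:R * u <=
        `|\sum_(i in sample_range a b w) cell_noise l k i w|)%R)]
    <= (2 * expR (- (N * u ^+ 2 / (2 * B ^+ 2))))%:E)%E.
Proof.
move=> u0.
pose A (k : {ffun 'I_n -> 'I_n.+2}) := [set w | N <= #|sample_range a b w|%:R /\
  #|sample_range a b w|%:R * u <=
        `|\sum_(i in sample_range a b w) cell_noise l k i w| ].
apply: (@conditional_cover_bound _ _ _ P C n 'I_n.+2 Y (fun k => cell B n k)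
  (fun i k w => cell_mass F B n (X i w) k) A).
- exact: Cm.
- by case: XY.
- by move=> k; exact: measurable_cell.
- by move=> i k; exact: cell_cond_prob.
- by move=> i k w; exact: cell_mass_ge0.
- move=> k.
  (* Splitting by the finitely many values of the range makes the index set of the sum
     deterministic. *)
  have -> : A k = \bigcup_(S : {set 'I_n}) ([set w | sample_range a b w = S] `&`
      [set w | N <= #|S|%:R /\ #|S|%:R * u <= `|\sum_(i in S) cell_noise l k i w| ]).
    apply/seteqP; split => w /=; first by move=> h; exists (sample_range a b w).
    by case=> S _ [<-].
  apply: (@fin_bigcup_measurable _ TG) => // S _.
  apply: measurableI; first exact: measurable_sample_range.
  have [NS|NS] := leP N #|S|%:R; last first.
    rewrite (_ : [set w | _] = set0); first exact: measurable0.
    by apply/seteqP; split => w //= [].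
  rewrite (_ : [set w | _] =
      [set w | #|S|%:R * u <= `|\sum_(i in S) cell_noise l k i w| ]); last first.
    by apply/seteqP; split => w /= => [[]|].
  have ms : measurable_fun setT (fun w : TG => \sum_(i <- enum S) cell_noise l k i w).
    exact: measurable_sum.
  have ma := measurableT_comp (@normr_measurable R setT) ms.
  have := measurable_bool_set (measurable_fun_ler
    (@measurable_cst _ _ TG _ setT (#|S|%:R * u)) ma).
  by congr measurable; apply/seteqP; split => w; rewrite /= big_enum.
- by move=> w [k [ck h]]; exists k => //; split => // i _; exact: ck.
- move=> w; set S := sample_range a b w.
  (* At an outcome whose range has fewer than [N] observations no cell vector qualifies, and the sum
     is empty. *)
  have [NS|NS] := leP N #|S|%:R; last first.
    rewrite big_pred0 ?mulr_ge0 ?expR_ge0// => k; apply/negbTE/negP.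
    by rewrite inE /A /= -/S => -[]; rewrite leNgt NS.
  apply: (@le_trans _ _ (2 * expR (- (2 * #|S|%:R * u ^+ 2 / (2 * B) ^+ 2)))).
    have := @hoeffding_two_sided R 'I_n 'I_n.+2 (fun i k => cell_mass F B n (X i w) k)
      (fun i k => grid_loss B n l k) S 0 (2 * B) u.
    have h1 (i : 'I_n) (k : 'I_n.+2) : 0 <= cell_mass F B n (X i w) k.
      exact: cell_mass_ge0.
    have h2 (i : 'I_n) : \sum_(k < n.+2) cell_mass F B n (X i w) k = 1.
      exact: cell_mass_total.
    have h3 (i : 'I_n) (k : 'I_n.+2) : 0 <= grid_loss B n l k <= 0 + 2 * B.
      by apply: grid_loss_bounds => //; rewrite -ltnS.
    have h4 : 0 < 2 * B by rewrite mulr_gt0.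
    move=> /(_ h1 h2 h3 h4 u0); apply: le_trans.
    rewrite le_eqVlt; apply/orP; left; apply/eqP; apply: eq_bigl => k.
    by apply/idP/idP; rewrite inE /A /= -/S; [case|split].
  rewrite ler_wpM2l// ler_expR lerN2.
  have -> : 2 * #|S|%:R * u ^+ 2 / (2 * B) ^+ 2 = #|S|%:R * (u ^+ 2 / (2 * B ^+ 2)).
    by field; rewrite gt_eqF.
  by rewrite -[leLHS]mulrA ler_wpM2r// divr_ge0 ?sqr_ge0// mulr_ge0// sqr_ge0.
Qed.

Lemma uniform_noise_prob (N u : R) : 0 <= u ->
  (mu_ext P [set w | exists a b y, (N <= #|sample_range a b w|%:R)%R /\
      (#|sample_range a b w|%:R * (u + (2 * grid_step B n + 2 * (tau * B))) <=
        `|\sum_(i in sample_range a b w) (Num.max (y - Y i w) 0 - Mfun F (X i w) y)|)%R ]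
    <= (2 * n%:R * tau + n%:R ^+ 2 * n.+1%:R *
        (2 * expR (- (N * u ^+ 2 / (2 * B ^+ 2)))))%:E)%E.
Proof.
move=> u0.
pose E0 := [set w | exists i, ~~ (- B < Y i w <= B)%R].
pose E1 (z : 'I_n * 'I_n * 'I_n.+1) := [set w | exists k : {ffun 'I_n -> 'I_n.+2},
      (forall i, cell B n (k i) (Y i w)) /\
      (N <= #|sample_range z.1.1 z.1.2 w|%:R /\ #|sample_range z.1.1 z.1.2 w|%:R * u <=
        `|\sum_(i in sample_range z.1.1 z.1.2 w) cell_noise z.2 k i w|)].
apply: (@le_trans _ _ (mu_ext P (E0 `|` \bigcup_z E1 z))).
  apply: le_mu_ext => w /= [a [b [y [NS hy]]]].
  have [E0w|E0w] := pselect (E0 w); [by left|right].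
  have Yin i : exists k : 'I_n.+2, (0 < k <= n)%N /\ cell B n k (Y i w).
    have : - B < Y i w <= B by apply/negPn/negP => h; apply: E0w; exists i.
    by move=> /(in_inner_cell n0)[k k0 ck]; exists k.
  pose k := [ffun i => projT1 (cid (Yin i))] : {ffun 'I_n -> 'I_n.+2}.
  have kP i : (0 < k i <= n)%N /\ cell B n (k i) (Y i w).
    by rewrite ffunE; exact: (projT2 (cid (Yin i))).
  (* The discretization error is at most [err] per summand, which is why the threshold exceeds [u]
     by just this amount. *)
  have [l hl] := grid_approx F B0 n0 tau0 y.
  exists (a, b, l) => //; exists k; split; first by move=> i; have [] := kP i.
  split => //=; set S := sample_range a b w in NS hy *.
  set err := 2 * grid_step B n + 2 * (tau * B) in hl hy.
  pose D i := Num.max (y - Y i w) 0 - Mfun F (X i w) y.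
  have hD : `|\sum_(i in S) D i| <=
      `|\sum_(i in S) cell_noise l k i w| + #|S|%:R * err.
    rewrite -lerBlDl; apply: le_trans (lerB_dist _ _) _.
    rewrite -sumrB; apply: le_trans (ler_norm_sum _ _ _) _.
    rewrite mulr_natl -sumr_const; apply: ler_sum => i _.
    by have [k0 ck] := kP i; apply: hl => //; exact: tail.
  by move: (le_trans hy hD); rewrite mulrDr lerD2r.
apply: (le_trans (outer_measureU2 _ _ _)).
rewrite EFinD; apply: leeD; first exact: outer_cells_prob.
apply: (le_trans (mu_ext_bigcup_le P (@subset_refl _ (\bigcup_z E1 z)))).
apply: (@le_trans _ _ (\sum_(z : 'I_n * 'I_n * 'I_n.+1)
  (2 * expR (- (N * u ^+ 2 / (2 * B ^+ 2))))%:E)%E).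
  by apply: lee_sum => -[[a b] l] _; exact: sample_range_noise_prob.
rewrite sumEFin sumr_const !card_prod !card_ord lee_fin.
by rewrite -[leLHS]mulr_natl !natrM expr2.
Qed.

End noise.

(** * Counts of independent covariates *)

Section counts.
Context d (Omega : measurableType d) (R : realType) (P : probability Omega R).

Lemma independent_count_prob (n : nat) (X : 'I_n -> {RV P >-> R}) (W : set R)
    (N v pi : R) :
  mutually_independent X -> measurable W ->
  (forall i, (pi%:E <= P (X i @^-1` W))%E) ->
  (0 < n)%N -> 0 < v -> N <= n%:R * (pi - v) ->
  (mu_ext P [set w | (#|[pred i | X i w \in W]|%:R < N)%R]
    <= (2 * n%:R * v ^+ 2)^-1%:E)%E.
Proof.
move=> indX mW piW n0 v0 NV.
have n0R : 0 < n%:R :> R by rewrite ltr0n.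
pose J (b : bool) := if b then W else ~` W.
have mJ b : measurable (J b) by case: b => //=; exact: measurableC.
have mXJ i b : measurable (X i @^-1` J b) by exact: measurable_funPTI.
pose q i b : R := fine (P (X i @^-1` J b)).
have qE i b : (q i b)%:E = P (X i @^-1` J b) by rewrite fineK// fin_num_measure.
have q1 i : \sum_b q i b = 1.
  rewrite big_bool/=; apply: EFin_inj; rewrite EFinD !qE.
  rewrite (_ : X i @^-1` J false = ~` (X i @^-1` J true))//.
  rewrite probability_setC; last exact: mXJ.
  rewrite addeC subeK; first by [].
  by apply: fin_num_measure; exact: mXJ.
have q0 i b : 0 <= q i b by rewrite fine_ge0// measure_ge0.
(* The sign turns a shortage of observations into an upper deviation. *)
pose f (i : 'I_n) (b : bool) : R := - b%:R.
pose bad (k : {ffun 'I_n -> bool}) := #|[set: 'I_n]%SET|%:R * v <=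
  \sum_(i in [set: 'I_n]%SET) (f i (k i) - \sum_j q i j * f i j).
pose A k := if bad k then \bigcap_i (X i @^-1` J (k i)) else set0.
have EA : [set w | #|[pred i | X i w \in W]|%:R < N] `<=` \bigcup_k A k.
  move=> w /= cN; pose k := [ffun i => X i w \in W].
  exists k => //; rewrite /A ifT.
    by move=> i _; rewrite /= ffunE; case: (boolP (X i w \in W)); rewrite ?inE ?notin_setE.
  rewrite /bad cardsT card_ord sumrB.
  have -> : \sum_(i in [set: 'I_n]%SET) f i (k i) = - #|[pred i | X i w \in W]|%:R.
    rewrite /f sumrN -natr_sum; congr (- _%:R).
    rewrite -sum1_card [RHS]big_mkcond [LHS]big_mkcond/=; apply: eq_bigr => i _.
    by rewrite !inE ffunE; case: ifP.
  have -> : \sum_(i in [set: 'I_n]%SET) \sum_j q i j * f i j = - \sum_(i < n) q i true.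
    rewrite -sumrN; apply: eq_big => [i|i _]; first by rewrite inE.
    by rewrite big_bool /f/= mulrN1 oppr0 mulr0 addr0.
  rewrite opprK.
  have : \sum_(i < n) pi <= \sum_(i < n) q i true.
    by apply: ler_sum => i _; rewrite -lee_fin qE.
  rewrite sumr_const card_ord -mulr_natl; lra.
apply: (le_trans (mu_ext_bigcup_le P EA)).
apply: (@le_trans _ _ (\sum_(k : {ffun 'I_n -> bool} | bad k) \prod_i q i (k i))%:E).
  rewrite -sumEFin [leRHS]big_mkcond/=; apply: lee_sum => k _; rewrite /A.
  case: ifP => _; last by rewrite mu_ext0.
  rewrite measurable_mu_extE; last by apply: fin_bigcap_measurable.
  rewrite -prodEFin; under eq_bigr do rewrite qE.
  by rewrite -(indX (fun i => J (k i))).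
rewrite lee_fin.
have f1 (i : 'I_n) b : -1 <= f i b <= -1 + 1 by rewrite /f; case: b => /=; lra.
have := @hoeffding_upper R 'I_n bool q f [set: 'I_n]%SET (-1) 1 v q0 q1 f1 ltr01 (ltW v0).
move=> /le_trans; apply.
(* The exponential bound is weakened by [x <= expR x]; an inverse bound suffices, because the union
   over windows costs only a factor of order [1 / delta]. *)
rewrite cardsT card_ord expr1n divr1 expRN lef_pV2 ?posrE ?expR_gt0//; last first.
  by rewrite !mulr_gt0// exprn_gt0.
by apply: le_trans (expR_ge1Dx _); rewrite lerDr.
Qed.

(** At least [3 N / 2] observations are expected in each admissible window. Giving up [N / 2] of
    them, that is [v = N / (2 n)], leaves [N] and turns [(2 n v^2)^-1] into [2 n / N^2]. *)
Lemma independent_counts_prob (n m : nat) (X : 'I_n -> {RV P >-> R})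
    (W : 'I_m -> set R) (Q : pred 'I_m) (N : R) :
  mutually_independent X -> (forall k, measurable (W k)) ->
  (forall i k, Q k -> ((3 / 2 * N / n%:R)%:E <= P (X i @^-1` W k))%E) ->
  (0 < n)%N -> 0 < N ->
  (mu_ext P [set w | exists2 k, Q k & (#|[pred i | X i w \in W k]|%:R < N)%R]
    <= (m%:R * (2 * n%:R / N ^+ 2))%:E)%E.
Proof.
move=> indX mW hW n0 N0.
have n0R : 0 < n%:R :> R by rewrite ltr0n.
pose A k := [set w | Q k /\ #|[pred i | X i w \in W k]|%:R < N].
apply: (@le_trans _ _ (\sum_(k < m) mu_ext P (A k))%E).
  by apply: mu_ext_bigcup_le => w /= [k Qk cN]; exists k.
apply: (@le_trans _ _ (\sum_(k < m) (2 * n%:R / N ^+ 2)%:E)%E); last first.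
  by rewrite sumEFin sumr_const card_ord lee_fin -[leLHS]mulr_natl.
apply: lee_sum => k _.
have [Qk|nQk] := boolP (Q k); last first.
  have -> : A k = set0.
    by apply/seteqP; split => w //= []; rewrite (negbTE nQk).
  have h : (0%:E <= (2 * n%:R / N ^+ 2)%:E)%E.
    by rewrite lee_fin; apply: divr_ge0; [rewrite mulr_ge0|exact: sqr_ge0].
  by rewrite mu_ext0.
have NV : N <= n%:R * (3 / 2 * N / n%:R - N / (2 * n%:R)).
  by rewrite le_eqVlt; apply/orP; left; apply/eqP; field; rewrite gt_eqF.
have v0 : 0 < N / (2 * n%:R) by rewrite divr_gt0// mulr_gt0.
have := independent_count_prob indX (mW k) (fun i => hW i k Qk) n0 v0 NV.
have -> : (2 * n%:R * (N / (2 * n%:R)) ^+ 2)^-1 = 2 * n%:R / N ^+ 2.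
  have N1 : N != 0 by rewrite gt_eqF.
  have n1 : n%:R != 0 :> R by rewrite gt_eqF.
  by field; rewrite N1 n1.
apply: le_trans; apply: le_mu_ext => w []//.
Qed.

End counts.

(** * Isotonic least squares *)

Section isotonic.
Context {R : realType} (n : nat) (x y : 'I_n -> R).
Local Notation xs := (distinct_values x).
Local Notation H z j := (Num.max (z - y j) 0).

Lemma mult_count v : mult x v = #|[pred j | x j == v]|.
Proof.
apply: eq_card => j; apply/idP/idP => [/set_mem//|jv].
exact/mem_set.
Qed.

Lemma mem_distinct_values v : reflect (exists j, v = x j) (v \in xs).
Proof.
rewrite mem_sort mem_undup; apply: (iffP codomP) => -[j ->]; by exists j.
Qed.

Lemma distinct_values_uniq : uniq xs.
Proof. by rewrite sort_uniq undup_uniq. Qed.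

Lemma distinct_values_sorted : sorted <%R xs.
Proof.
by rewrite lt_sorted_uniq_le distinct_values_uniq sort_le_sorted.
Qed.

Lemma nth_distinct_values_lt (s t : nat) : (s < t)%N -> (t < size xs)%N -> xs`_s < xs`_t.
Proof.
move=> st tn.
by apply: (sorted_ltn_nth lt_trans 0 distinct_values_sorted) => //; rewrite inE (ltn_trans st).
Qed.

Lemma nth_distinct_values (s : nat) : (s < size xs)%N -> exists j, xs`_s = x j.
Proof. by move=> sn; apply/mem_distinct_values/mem_nth. Qed.

Lemma sum_distinct_values (f : 'I_n -> R) :
  \sum_(v <- xs) \sum_(j < n | x j == v) f j = \sum_(j < n) f j.
Proof.
under eq_bigr do rewrite big_mkcond/=.
rewrite exchange_big/=; apply: eq_bigr => j _.
have jx : x j \in xs by apply/mem_distinct_values; exists j.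
rewrite (bigD1_seq (x j)) ?distinct_values_uniq//= eqxx big1 ?addr0// => v.
by rewrite eq_sym => /negbTE ->.
Qed.

(* The within-group variance does not depend on the candidate, so the weighted
   and the unweighted least squares problems are equivalent. *)
Lemma sq_loss_unweighted z : exists c, forall phi : R -> R,
  sq_loss y z (fun s : 'I_(size xs) => phi xs`_s) + c =
  \sum_(j < n) (phi (x j) - H z j) ^+ 2.
Proof.
exists (\sum_(v <- xs) \sum_(j < n | x j == v) (H z j - hmean x y v z) ^+ 2) => phi.
rewrite -(sum_distinct_values (fun j => (phi (x j) - H z j) ^+ 2)) /sq_loss.
rewrite -(big_mkord xpredT (fun s => (mult x xs`_s)%:R * (phi xs`_s - hmean x y xs`_s z) ^+ 2)).
rewrite -(big_nth 0 xpredT (fun v => (mult x v)%:R * (phi v - hmean x y v z) ^+ 2)).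
rewrite -big_split/= big_seq [RHS]big_seq; apply: eq_bigr => v vx.
have mE : \sum_(j < n | x j == v) (1 : R) = (mult x v)%:R.
  by rewrite sumr_const mult_count.
have m0 : (mult x v)%:R != 0 :> R.
  rewrite pnatr_eq0 -lt0n mult_count; apply/card_gt0P.
  by have /mem_distinct_values[j ->] := vx; exists j; rewrite inE.
have hE : \sum_(j < n | x j == v) H z j = (mult x v)%:R * hmean x y v z.
  by rewrite /hmean mulVKf.
rewrite [RHS](eq_bigr (fun j => (phi v - hmean x y v z) ^+ 2 * 1 +
    (2 * (phi v - hmean x y v z) * (hmean x y v z * 1) -
     2 * (phi v - hmean x y v z) * H z j) + (H z j - hmean x y v z) ^+ 2)); last first.
  by move=> j /eqP ->; ring.
rewrite !big_split/= sumrN -!mulr_sumr hE mE; ring.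
Qed.

Definition sample_antitone (phi : R -> R) :=
  forall i j, x i <= x j -> phi (x j) <= phi (x i).

Lemma antitonic_sample (phi : R -> R) :
  antitonic (x := x) (fun s => phi xs`_s) <-> sample_antitone phi.
Proof.
split => h.
  move=> i j ij.
  have ix : x i \in xs by apply/mem_distinct_values; exists i.
  have jx : x j \in xs by apply/mem_distinct_values; exists j.
  have is_ : (index (x i) xs < size xs)%N by rewrite index_mem.
  have js : (index (x j) xs < size xs)%N by rewrite index_mem.
  have := h (Ordinal is_) (Ordinal js); rewrite /= !nth_index//; apply.
  rewrite leqNgt; apply/negP => /nth_distinct_values_lt/(_ is_).
  by rewrite !nth_index// ltNge ij.
move=> s t st.
have [i Ei] := nth_distinct_values (ltn_ord s).
have [j Ej] := nth_distinct_values (ltn_ord t).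
rewrite Ei Ej; apply: h; rewrite -Ei -Ej.
move: st; rewrite leq_eqVlt => /predU1P[->//|st].
by apply/ltW/nth_distinct_values_lt.
Qed.

Lemma isotonic_lsq_min (phi psi : R -> R) z :
  isotonic_lsq y z (fun s : 'I_(size xs) => phi xs`_s) ->
  sample_antitone psi ->
  \sum_(j < n) (phi (x j) - H z j) ^+ 2 <= \sum_(j < n) (psi (x j) - H z j) ^+ 2.
Proof.
move=> [_ hmin] /antitonic_sample/hmin.
by have [c hc] := sq_loss_unweighted z; rewrite -(lerD2r c) !hc.
Qed.

(** First-order optimality: the loss has a nonnegative one-sided derivative in every admissible
    direction [v]. *)
Lemma isotonic_lsq_variation (phi v : R -> R) z (e0 : R) :
  isotonic_lsq y z (fun s : 'I_(size xs) => phi xs`_s) ->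
  0 < e0 -> (forall e, 0 < e -> e <= e0 -> sample_antitone (fun t => phi t + e * v t)) ->
  0 <= \sum_(j < n) v (x j) * (phi (x j) - H z j).
Proof.
move=> lsq e00 hv; rewrite leNgt; apply/negP.
set A := \sum_(j < n) _ => A0.
pose V := \sum_(j < n) v (x j) ^+ 2.
have V0 : 0 <= V by apply: sumr_ge0 => j _; exact: sqr_ge0.
(* The change of the loss is [e * (2 * A + e * V)], and this step size keeps [e * V] below [- A];
   the added 1 covers [V = 0]. *)
pose e := Num.min e0 (- A / (V + 1)).
have e_gt0 : 0 < e by rewrite lt_min e00 divr_gt0//; lra.
have ee0 : e <= e0 by rewrite ge_min lexx.
have eV : e * V <= - A.
  have : e * (V + 1) <= - A by rewrite -ler_pdivlMr ?ge_min ?lexx ?orbT//; lra.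
  by nra.
have := isotonic_lsq_min lsq (hv e e_gt0 ee0).
have -> : \sum_(j < n) (phi (x j) + e * v (x j) - H z j) ^+ 2 =
    \sum_(j < n) (phi (x j) - H z j) ^+ 2 + e * (2 * A + e * V).
  rewrite /A /V mulrDr !mulr_sumr -!big_split/=; apply: eq_bigr => j _; ring.
rewrite lerDl pmulr_rge0//; lra.
Qed.

Section bounds.
Variables (phi : R -> R) (z : R).
Hypothesis lsq : isotonic_lsq y z (fun s : 'I_(size xs) => phi xs`_s).

Let anti : sample_antitone phi.
Proof. by apply/antitonic_sample; case: lsq. Qed.

(** Perturbations no larger than the least positive difference of fitted values cannot reverse their
    order. The initial value 1 covers the case of no positive difference. *)
Let gap (T : finType) (f : T -> R) : exists2 e0 : R, 0 < e0 & forall t, 0 < f t -> e0 <= f t.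
Proof.
exists (\big[Num.min/1]_(t | 0 < f t) f t); first by apply/lt_bigmin.
by move=> t ft; exact: bigmin_le_cond.
Qed.

(* Lowering the fit on the sample points to the right of [x k] whose fitted
   value is at least that at [x i] stays admissible. *)
Lemma isotonic_lsq_upper i k : x k <= x i -> exists2 b, x i <= x b &
  #|[pred j | x k <= x j <= x b]|%:R * phi (x i) <=
    \sum_(j < n | x k <= x j <= x b) H z j.
Proof.
move=> ki.
pose v (t : R) : R := if (x k <= t) && (phi (x i) <= phi t) then - 1 else 0.
have [e0 e00 he0] := gap (fun j => phi (x i) - phi (x j)).
have var : 0 <= \sum_(j < n) v (x j) * (phi (x j) - H z j).
  apply: (isotonic_lsq_variation lsq e00) => e ep ee0 j l jl.
  have ajl := anti jl; rewrite /v.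
  case: ifPn => [/andP[kl il]|nl]; case: ifPn => [/andP[kj ij]|nj]; try lra.
  (* Only a lowered point to the left of an unlowered one could break the order; the fit at the
     latter is then below [phi (x i)] by at least [e0]. *)
  move: nl; rewrite (le_trans kj jl) /= -ltNge => li.
  have := he0 l; rewrite subr_gt0 => /(_ li); lra.
have ii : (x k <= x i) && (phi (x i) <= phi (x i)) by rewrite ki lexx.
case: (@arg_maxP _ _ _ i (fun j => (x k <= x j) && (phi (x i) <= phi (x j))) x ii)
  => b /andP[kb ib] bmax.
exists b; first exact: bmax.
(* As [phi] is antitone, the lowered points fill the whole range up to the rightmost of them,
   [x b]. *)
have E j : (x k <= x j <= x b) = (x k <= x j) && (phi (x i) <= phi (x j)).
  apply/idP/idP => [/andP[kj jb]|/andP[kj ij]].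
    by rewrite kj (le_trans ib)//; exact: anti.
  by rewrite kj; apply: bmax; rewrite kj ij.
have : \sum_(j < n | x k <= x j <= x b) phi (x i) <=
    \sum_(j < n | x k <= x j <= x b) H z j.
  apply: (@le_trans _ _ (\sum_(j < n | x k <= x j <= x b) phi (x j))).
    by apply: ler_sum => j; rewrite E => /andP[].
  rewrite -subr_ge0 -sumrB; apply: (le_trans var).
  rewrite [leRHS]big_mkcond/=; apply: ler_sum => j _; rewrite E /v.
  by case: ifP; lra.
by rewrite sumr_const -[leLHS]mulr_natl.
Qed.

(** Mirror image of [isotonic_lsq_upper]: the points up to [x k] with fitted value at most
    [phi (x i)] are raised, and [x a] is the leftmost of them. *)
Lemma isotonic_lsq_lower i k : x i <= x k -> exists2 a, x a <= x i &
  \sum_(j < n | x a <= x j <= x k) H z j <=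
  #|[pred j | x a <= x j <= x k]|%:R * phi (x i).
Proof.
move=> ik.
pose v (t : R) : R := if (t <= x k) && (phi t <= phi (x i)) then 1 else 0.
have [e0 e00 he0] := gap (fun j => phi (x j) - phi (x i)).
have var : 0 <= \sum_(j < n) v (x j) * (phi (x j) - H z j).
  apply: (isotonic_lsq_variation lsq e00) => e ep ee0 j l jl.
  have ajl := anti jl; rewrite /v.
  case: ifPn => [/andP[lk li]|nl]; case: ifPn => [/andP[jk ji]|nj]; try lra.
  move: nj; rewrite (le_trans jl lk) /= -ltNge => ij.
  have := he0 j; rewrite subr_gt0 => /(_ ij); lra.
have ii : (x i <= x k) && (phi (x i) <= phi (x i)) by rewrite ik lexx.
case: (@arg_minP _ _ _ i (fun j => (x j <= x k) && (phi (x j) <= phi (x i))) x ii)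
  => a /andP[ak ai] amin.
exists a; first exact: amin.
have E j : (x a <= x j <= x k) = (x j <= x k) && (phi (x j) <= phi (x i)).
  apply/idP/idP => [/andP[aj jk]|/andP[jk ji]].
    by rewrite jk (le_trans _ ai)//; exact: anti.
  by rewrite jk andbT; apply: amin; rewrite jk ji.
have : \sum_(j < n | x a <= x j <= x k) H z j <=
    \sum_(j < n | x a <= x j <= x k) phi (x i).
  apply: (@le_trans _ _ (\sum_(j < n | x a <= x j <= x k) phi (x j))); last first.
    by apply: ler_sum => j; rewrite E => /andP[].
  rewrite -subr_ge0 -sumrB; apply: (le_trans var).
  rewrite [leRHS]big_mkcond/=; apply: ler_sum => j _; rewrite E /v.
  by case: ifP; lra.
by rewrite sumr_const -[leRHS]mulr_natl.
Qed.

End bounds.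
End isotonic.

(** * Pointwise error of the estimator *)

Section estimator_error.
Context {R : realType} (n : nat) (x y : 'I_n -> R) (I : set R) (Mt M : R -> R -> R).
Local Notation xs := (distinct_values x).
Local Notation H z j := (Num.max (z - y j) 0).
Hypothesis est : is_estimator x y I Mt.
Hypothesis xI : forall j, I (x j).

Lemma estimator_le_left (v : R) i z : I v -> x i <= v ->
  (forall j, x j <= v -> x j <= x i) -> Mt v z <= Mt (x i) z.
Proof.
move=> Iv iv imax.
have [vx|vx] := boolP (v \in xs).
  have /mem_distinct_values[j vj] := vx.
  suff -> : x i = v by [].
  by apply/le_anti; rewrite iv /= {1}vj; apply: imax; rewrite -vj.
have [_ /(_ v Iv vx)[h1 _ h3]] := est.
have ix : x i \in xs by apply/mem_distinct_values; exists i.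
have is_ : (index (x i) xs < size xs)%N by rewrite index_mem.
set s := index (x i) xs in is_.
have Es : xs`_s = x i by exact: nth_index.
have [sn|sn] := ltnP s.+1 (size xs).
  have vs : xs`_s <= v < xs`_s.+1.
    rewrite Es iv /= ltNge; apply/negP.
    have [j Ej] := nth_distinct_values sn.
    rewrite Ej => /imax; rewrite -Ej -Es leNgt => /negP; apply.
    exact: nth_distinct_values_lt.
  by have /andP[_] := h1 s sn vs z; rewrite Es.
have E : s = (size xs).-1 by apply/eqP; rewrite eqn_leq; apply/andP; split; lia.
rewrite h3 -?E ?Es//; lia.
Qed.

Lemma estimator_ge_right (v : R) i z : I v -> v <= x i ->
  (forall j, v <= x j -> x i <= x j) -> Mt (x i) z <= Mt v z.
Proof.
move=> Iv iv imin.
have [vx|vx] := boolP (v \in xs).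
  have /mem_distinct_values[j vj] := vx.
  suff -> : x i = v by [].
  by apply/le_anti; rewrite iv andbT vj; apply: imin; rewrite -vj.
have [_ /(_ v Iv vx)[h1 h2 _]] := est.
have ix : x i \in xs by apply/mem_distinct_values; exists i.
have vi : v < x i by rewrite lt_neqAle iv andbT; apply: contraNneq vx => ->.
have is_ : (index (x i) xs < size xs)%N by rewrite index_mem.
have Es : xs`_(index (x i) xs) = x i by exact: nth_index.
case: (index (x i) xs) is_ Es => [|s] sn Es.
  by rewrite h2 ?Es.
have vs : xs`_s <= v < xs`_s.+1.
  rewrite Es vi andbT leNgt; apply/negP => vs.
  have [j Ej] := nth_distinct_values (ltnW sn).
  have := imin j; rewrite -Ej => /(_ (ltW vs)); rewrite -Es leNgt => /negP; apply.
  exact: nth_distinct_values_lt.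
by have /andP[+ _] := h1 s sn vs z; rewrite Es.
Qed.

Variables (v z delta N t' Ld : R).
Hypotheses (Iv : I v) (N0 : 0 < N).
Hypothesis M_antitone : forall u u', I u -> I u' -> u <= u' -> M u' z <= M u z.
Hypothesis M_near : forall u, I u -> `|u - v| <= delta -> `|M u z - M v z| <= Ld.
Hypothesis noise : forall a b, N <= #|[pred j | x a <= x j <= x b]|%:R ->
  `|\sum_(j < n | x a <= x j <= x b) (H z j - M (x j) z)|
    < #|[pred j | x a <= x j <= x b]|%:R * t'.

Lemma estimator_upper_error : N <= #|[pred j | v - delta <= x j <= v]|%:R ->
  Mt v z - M v z < Ld + t'.
Proof.
move=> Nw.
have [j0 /andP[dj0 j0v]] : exists j, v - delta <= x j <= v.
  by apply/card_gt0P; rewrite -(ltr0n R) (lt_le_trans N0).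
case: (@arg_maxP _ _ _ j0 (fun j => x j <= v) x j0v) => i iv /= imax.
case: (@arg_minP _ _ _ j0 (fun j => v - delta <= x j) x dj0) => k dk /= kmin.
have ki : x k <= x i by rewrite (le_trans (kmin _ dj0))// imax.
have [b ib hb] := isotonic_lsq_upper (phi := Mt^~ z) (est.1 z) ki.
set S := [pred j | x k <= x j <= x b] in hb.
have NS : N <= #|S|%:R.
  apply: (le_trans Nw); rewrite ler_nat; apply: subset_leq_card; apply/fintype.subsetP => j.
  by rewrite !inE => /andP[dj jv]; rewrite kmin// (le_trans _ ib)// imax.
have S0 : 0 < #|S|%:R :> R by exact: lt_le_trans NS.
(* The point [x b] may lie far to the right of [v]; as [M] decreases in the covariate, this only
   lowers the average, and the bias is governed by [x k] alone. *)
have hM : \sum_(j < n | x k <= x j <= x b) M (x j) z <= #|S|%:R * M (x k) z.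
  rewrite mulr_natl -sumr_const; apply: ler_sum => j /andP[kj _].
  exact: M_antitone.
have := ltr_normlW (noise NS); rewrite sumrB -/S => hn.
have hk : M (x k) z <= M v z + Ld.
  rewrite -lerBlDl; apply: ler_normlW; apply: M_near => //.
  by rewrite ler_distl dk/= (le_trans ki)// (le_trans iv)// lerDl; lra.
have hv := estimator_le_left z Iv iv imax.
rewrite -(ltr_pM2l S0); nra.
Qed.

Lemma estimator_lower_error : N <= #|[pred j | v <= x j <= v + delta]|%:R ->
  M v z - Mt v z < Ld + t'.
Proof.
move=> Nw.
have [j0 /andP[j0v dj0]] : exists j, v <= x j <= v + delta.
  by apply/card_gt0P; rewrite -(ltr0n R) (lt_le_trans N0).
case: (@arg_minP _ _ _ j0 (fun j => v <= x j) x j0v) => i iv /= imin.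
case: (@arg_maxP _ _ _ j0 (fun j => x j <= v + delta) x dj0) => k dk /= kmax.
have ik : x i <= x k by rewrite (le_trans (imin _ j0v))// kmax.
have [a ai ha] := isotonic_lsq_lower (phi := Mt^~ z) (est.1 z) ik.
set S := [pred j | x a <= x j <= x k] in ha.
have NS : N <= #|S|%:R.
  apply: (le_trans Nw); rewrite ler_nat; apply: subset_leq_card; apply/fintype.subsetP => j.
  by rewrite !inE => /andP[dj jv]; rewrite kmax// (le_trans ai)// imin.
have S0 : 0 < #|S|%:R :> R by exact: lt_le_trans NS.
have hM : #|S|%:R * M (x k) z <= \sum_(j < n | x a <= x j <= x k) M (x j) z.
  rewrite mulr_natl -sumr_const; apply: ler_sum => j /andP[_ jk].
  exact: M_antitone.
have := noise NS; rewrite -normrN => /ltr_normlW; rewrite sumrB -/S => hn.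
have hk : M v z - Ld <= M (x k) z.
  rewrite lerBlDr -lerBlDl; apply: ler_normlW; rewrite distrC; apply: M_near => //.
  by rewrite ler_distl dk andbT (le_trans _ ik)// (le_trans _ iv)//; lra.
have hv := estimator_ge_right z Iv iv imin.
rewrite -(ltr_pM2l S0); nra.
Qed.

End estimator_error.

(** * Finite-sample bound *)

Section finite_sample.
Context d (Omega : measurableType d) (R : realType) (P : probability Omega R).
Context (I : set R) (F : R -> cumulativeBounded (0 : R) (1 : R)) (n : nat).
Context (X Y : 'I_n -> {RV P >-> R}) (Mt : Omega -> R -> R -> R).
Hypothesis Finc : icv_increasing I F.
Hypothesis XY : sampling_model I F X Y.
Hypothesis est : forall w, is_estimator (fun i => X i w) (fun i => Y i w) I (Mt w).
Hypothesis n0 : (0 < n)%N.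
Variables (B tau : R).
Hypotheses (B0 : 0 < B) (tau0 : 0 <= tau).
Hypothesis tail : forall x, I x -> tail_bounded F B tau x.
Variables (J : set R) (m : nat) (W : 'I_m -> set R) (Q : pred 'I_m).
Variables (N u delta Ld c : R).
Hypothesis mW : forall k, measurable (W k).
Hypothesis PW : forall i k, Q k -> ((3 / 2 * N / n%:R)%:E <= P (X i @^-1` W k))%E.
Hypotheses (N0 : 0 < N) (u0 : 0 <= u).
Hypothesis JI : forall v, J v -> I v.
Hypothesis Jleft : forall v, J v -> exists2 k, Q k & W k `<=` `[v - delta, v].
Hypothesis Jright : forall v, J v -> exists2 k, Q k & W k `<=` `[v, v + delta].
Hypothesis Jnear : forall v v' z, J v -> I v' -> `|v' - v| <= delta ->
  `|Mfun F v' z - Mfun F v z| <= Ld.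
Hypothesis budget : N <= n%:R -> Ld + (u + (2 * grid_step B n + 2 * (tau * B))) < c.

Lemma finite_sample_bound :
  (mu_ext P [set w | (c%:E <= ereal_sup [set `|Mt w x y - Mfun F x y|%:E
      | y in [set: R] & x in J])%E]
   <= (2 * n%:R * tau + n%:R ^+ 2 * n.+1%:R * (2 * expR (- (N * u ^+ 2 / (2 * B ^+ 2))))
       + m%:R * (2 * n%:R / N ^+ 2))%:E)%E.
Proof.
have [indX XI _ _] := XY.
rewrite EFinD; apply: (le_trans _ (leeD (uniform_noise_prob XY n0 B0 tau0 tail N u0)
  (independent_counts_prob indX mW PW n0 N0))).
apply: (le_trans _ (outer_measureU2 _ _ _)); apply: le_mu_ext => w /= cw.
apply: contrapT => /not_orP[nonoise nocount].
have budget' := budget.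
set t' := u + (2 * grid_step B n + 2 * (tau * B)) in nonoise budget'.
have cnt k : Q k -> N <= #|[pred i | X i w \in W k]|%:R.
  by move=> Qk; rewrite leNgt; apply/negP => h; apply: nocount; exists k.
have noise z a b : N <= #|[pred j | X a w <= X j w <= X b w]|%:R ->
  `|\sum_(j < n | X a w <= X j w <= X b w) (Num.max (z - Y j w) 0 - Mfun F (X j w) z)|
    < #|[pred j | X a w <= X j w <= X b w]|%:R * t'.
  have cE : #|sample_range X a b w| = #|[pred j | X a w <= X j w <= X b w]|.
    by apply: eq_card => j; rewrite !inE.
  move=> Nab; rewrite ltNge; apply/negP => h; apply: nonoise.
  exists a, b, z; rewrite cE; split => //.
  by under eq_bigl do rewrite inE.
have wnd (k : 'I_m) lo hi : Q k -> W k `<=` `[lo, hi] ->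
    N <= #|[pred j | lo <= X j w <= hi]|%:R.
  move=> Qk Wk; apply: (le_trans (cnt k Qk)); rewrite ler_nat.
  apply: subset_leq_card; apply/fintype.subsetP => j; rewrite !inE => jW.
  by have := Wk _ jW; rewrite /= in_itv.
have key v z : J v -> `|Mt w v z - Mfun F v z| < Ld + t'.
  move=> Jv.
  have near v' : I v' -> `|v' - v| <= delta -> `|Mfun F v' z - Mfun F v z| <= Ld.
    by move=> Iv'; exact: Jnear.
  have anti s s' : I s -> I s' -> s <= s' -> Mfun F s' z <= Mfun F s z.
    by move=> Is Is' ss; exact: Finc.
  have [k Qk Wk] := Jleft Jv; have [k' Qk' Wk'] := Jright Jv.
  have h1 := estimator_upper_error (est w) (fun j => XI j w) (JI Jv) N0 anti near (noise z)
    (wnd k _ _ Qk Wk).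
  have h2 := estimator_lower_error (est w) (fun j => XI j w) (JI Jv) N0 anti near (noise z)
    (wnd k' _ _ Qk' Wk').
  by rewrite ltr_norml h1 andbT ltrNl opprB.
(* Over an empty [J] the supremum is [-oo] and the event is empty. A point of [J] supplies a window,
   whose probability is at most 1, whence [N <= n]. *)
have [[v Jv]|J0] := pselect (exists v, J v); last first.
  move: cw; rewrite (_ : [set _ | _ in _ & _ in _] = set0) ?ereal_sup0 ?leeNy_eq//.
  by apply/seteqP; split => // r /= [z _ [v Jv _]]; apply: J0; exists v.
have Nn : N <= n%:R.
  have [k Qk _] := Jleft Jv.
  have := le_trans (PW (Ordinal n0) Qk) (probability_le1 _ (measurable_funPTI _ (mW k))).
  rewrite lee_fin ler_pdivrMr ?ltr0n// mul1r.
  by apply: le_trans; rewrite ler_peMl ?(ltW N0)//; lra.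
(* The strict pointwise bounds become weak in the supremum; the contradiction comes from the strict
   inequality in [budget]. *)
have : (c%:E <= (Ld + t')%:E)%E.
  apply: (le_trans cw); apply: ub_ereal_sup => r /= [z _ [v' Jv' <-]].
  by rewrite lee_fin ltW// key.
by rewrite lee_fin leNgt budget'.
Qed.

End finite_sample.

(** * Choice of the noise level *)

Section rate.
Context d (Omega : measurableType d) (R : realType) (P : probability Omega R).
Context (I : set R) (F : R -> cumulativeBounded (0 : R) (1 : R)) (n : nat).
Context (X Y : 'I_n -> {RV P >-> R}) (Mt : Omega -> R -> R -> R).
Hypothesis Finc : icv_increasing I F.
Hypothesis XY : sampling_model I F X Y.
Hypothesis est : forall w, is_estimator (fun i => X i w) (fun i => Y i w) I (Mt w).
Variables (B tau : R).
Hypothesis B0 : 0 < B.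
Hypothesis tail : forall x, I x -> tail_bounded F B tau x.
Hypotheses (tau0 : 0 <= tau) (tau_n : tau <= n%:R^-1) (n_tau : n%:R * tau <= (ln n%:R)^-1).
Hypotheses (ln1 : 1 <= ln n%:R :> R) (n_ln : 1152 < n%:R * ln n%:R :> R).
Variables (J : set R) (m : nat) (W : 'I_m -> set R) (Q : pred 'I_m).
Variables (N t delta Ld D : R).
Hypothesis mW : forall k, measurable (W k).
Hypothesis PW : forall i k, Q k -> ((3 / 2 * N / n%:R)%:E <= P (X i @^-1` W k))%E.
Hypotheses (N0 : 0 < N) (t0 : 0 <= t).
Hypothesis JI : forall v, J v -> I v.
Hypothesis Jleft : forall v, J v -> exists2 k, Q k & W k `<=` `[v - delta, v].
Hypothesis Jright : forall v, J v -> exists2 k, Q k & W k `<=` `[v, v + delta].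
Hypothesis Jnear : forall v v' z, J v -> I v' -> `|v' - v| <= delta ->
  `|Mfun F v' z - Mfun F v z| <= Ld.
Hypothesis Nt : N * t ^+ 2 = 8 * B ^+ 2 * ln n%:R.
Hypothesis mND : m%:R * (2 * n%:R / N ^+ 2) <= D / ln n%:R.

(* The noise level is [15/16 t]; the remaining [t/16] absorbs the grid and
   truncation errors, and the exponent [225/64 * ln n] still beats the
   [n^2 (n + 1)] terms of the union bound. *)
Lemma finite_sample_rate :
  (mu_ext P [set w | ((Ld + t)%:E <= ereal_sup [set `|Mt w x y - Mfun F x y|%:E
      | y in [set: R] & x in J])%E] <= ((10 + D) / ln n%:R)%:E)%E.
Proof.
have l0 : 0 < ln n%:R :> R by exact: lt_le_trans ln1.
have n0 : (0 < n)%N by rewrite lt0n; apply: contraTneq n_ln => ->; rewrite mul0r -leNgt ler0n.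
have nR : 0 < n%:R :> R by rewrite ltr0n.
have u0 : 0 <= 15 / 16 * t by rewrite mulr_ge0.
apply: (le_trans (@finite_sample_bound _ _ _ P I F n X Y Mt Finc XY est n0 B tau B0 tau0
  tail J m W Q N (15 / 16 * t) delta Ld (Ld + t) mW PW N0 u0 JI Jleft Jright Jnear _)).
  move=> Nn; rewrite ltrD2l.
  have tB : tau * B <= B / n%:R by rewrite mulrC ler_wpM2l// ltW.
  rewrite /grid_step.
  (* Grid and truncation errors add up to at most [6 B / n], to be kept below [t / 16]. As [N <= n],
     [t ^+ 2] is at least [8 (B / n)^2 n ln n], and [96 ^ 2 / 8 = 1152]. *)
  suff : 96 * (B / n%:R) < t by rewrite -mulrA; lra.
  have Bn0 : 0 < B / n%:R by rewrite divr_gt0.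
  rewrite -(ltr_pXn2r (n := 2)) ?nnegrE//; last by rewrite mulr_ge0// ltW.
  have Bn : B = n%:R * (B / n%:R) by rewrite mulrC divfK// gt_eqF.
  set b := B / n%:R in Bn Bn0 *.
  have : 8 * B ^+ 2 * ln n%:R <= n%:R * t ^+ 2.
    by rewrite -Nt ler_wpM2r// sqr_ge0.
  rewrite Bn => h.
  have h2 : n%:R * ((96 * b) ^+ 2) < n%:R * (8 * b ^+ 2 * (n%:R * ln n%:R)).
    rewrite ltr_pM2l// exprMn.
    have b2 : 0 < b ^+ 2 by rewrite exprn_gt0.
    have -> : 96 ^+ 2 * b ^+ 2 = 8 * b ^+ 2 * 1152 by ring.
    by rewrite ltr_pM2l// mulr_gt0.
  rewrite -(ltr_pM2l nR); apply: (lt_le_trans h2); apply: le_trans h.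
  by rewrite le_eqVlt; apply/orP; left; apply/eqP; ring.
rewrite lee_fin.
have -> : N * (15 / 16 * t) ^+ 2 / (2 * B ^+ 2) = 225 / 64 * ln n%:R.
  have -> : N * (15 / 16 * t) ^+ 2 = 225 / 256 * (N * t ^+ 2) by field.
  by rewrite Nt; field; rewrite gt_eqF.
have h1 : 2 * n%:R * tau <= 2 / ln n%:R by rewrite -mulrA ler_wpM2l.
have h2 : n%:R ^+ 2 * n.+1%:R * (2 * expR (- (225 / 64 * ln n%:R))) <= 8 / ln n%:R :> R.
  (* Since 225/64 exceeds 7/2, a factor [n ^ -3] is available against the number of events, and
     [n ^ (-1/2)] remains. *)
  have e1 : expR (- (225 / 64 * ln n%:R)) <= (n%:R ^+ 3)^-1 * expR (- (ln n%:R / 2)) :> R.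
    have -> : n%:R ^+ 3 = expR (3 * ln n%:R) :> R by rewrite expRM_natl lnK ?posrE.
    rewrite -expRN -expRD ler_expR; lra.
  have e2 : expR (- (ln n%:R / 2)) <= 2 / ln n%:R :> R.
    rewrite expRN -[leRHS]invf_div lef_pV2 ?posrE ?expR_gt0 ?divr_gt0//.
    by apply: le_trans (expR_ge1Dx _); rewrite lerDr.
  have n1 : n.+1%:R <= 2 * n%:R :> R.
    by rewrite -natr1; have : 1 <= n%:R :> R by [rewrite ler1n]; lra.
  apply: (@le_trans _ _ (n%:R ^+ 2 * (2 * n%:R) * (2 * ((n%:R ^+ 3)^-1 * (2 / ln n%:R))))).
    apply: ler_pM.
    - by apply: mulr_ge0 => //; exact: exprn_ge0.
    - by rewrite mulr_ge0// expR_ge0.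
    - by rewrite ler_wpM2l// exprn_ge0.
    - rewrite ler_wpM2l//; apply: (le_trans e1); exact: ler_wpM2l.
  have n1' : n%:R != 0 :> R by rewrite gt_eqF.
  have l1' : ln n%:R != 0 :> R by rewrite gt_eqF.
  by rewrite le_eqVlt; apply/orP; left; apply/eqP; field; rewrite n1' l1'.
have -> : (10 + D) / ln n%:R = 2 / ln n%:R + 8 / ln n%:R + D / ln n%:R by lra.
by apply: lerD => //; apply: lerD.
Qed.

End rate.

Lemma ln_natr_le {R : realType} n : (0 < n)%N -> ln n%:R <= n%:R :> R.
Proof.
move=> n0; rewrite -ler_expR lnK ?posrE ?ltr0n//.
by apply: le_trans (expR_ge1Dx _); rewrite lerDr.
Qed.

Lemma bigmine_le {R : realType} (T : eqType) (s : seq T) (f : T -> \bar R) j :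
  j \in s -> (\big[mine/+oo]_(i <- s) f i <= f j)%E.
Proof.
elim: s => // a s ih; rewrite big_cons inE => /predU1P[->|/ih h].
  by rewrite ge_min lexx.
by rewrite ge_min h orbT.
Qed.

(** * Windows for atomic and for continuous covariates *)

Section covariate_windows.
Context d (Omega : measurableType d) (R : realType) (P : probability Omega R).
Context (I : set R) (F : R -> cumulativeBounded (0 : R) (1 : R)) (n : nat).
Context (X Y : 'I_n -> {RV P >-> R}) (Mt : Omega -> R -> R -> R).
Hypothesis Finc : icv_increasing I F.
Hypothesis XY : sampling_model I F X Y.
Hypothesis est : forall w, is_estimator (fun i => X i w) (fun i => Y i w) I (Mt w).
Variables (B tau p : R).
Hypotheses (B1 : 1 <= B) (p0 : 0 < p).
Hypothesis tail : forall x, I x -> tail_bounded F B tau x.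
Hypotheses (tau0 : 0 <= tau) (tau_n : tau <= n%:R^-1) (n_tau : n%:R * tau <= (ln n%:R)^-1).
Hypotheses (ln1 : 1 <= ln n%:R :> R) (n_ln : 1152 < n%:R * ln n%:R :> R).

Let B0 : 0 < B. Proof. exact: lt_le_trans B1. Qed.
Let l0 : 0 < ln n%:R :> R. Proof. exact: lt_le_trans ln1. Qed.
Let n0 : (0 < n)%N.
Proof. by rewrite lt0n; apply: contraTneq n_ln => ->; rewrite mul0r -leNgt ler0n. Qed.
Let nR : 0 < n%:R :> R. Proof. by rewrite ltr0n. Qed.
Let ln_le : ln n%:R <= n%:R :> R. Proof. exact: ln_natr_le. Qed.

(** The windows are single atoms, so there is no bias. Requiring [N = n p / 2] observations per atom
    asks for a mass of [3 p / 4], less than the available [p]. *)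
Lemma discrete_rate (K : nat) (t : R) :
  I = [set k%:R | k in [set k | (1 <= k <= K)%N]] ->
  (forall i : 'I_n, \big[mine/+oo%E]_(1 <= j < K.+1) P (X i @^-1` [set j%:R]) = p%:E) ->
  0 <= t -> n%:R * p / 2 * t ^+ 2 = 8 * B ^+ 2 * ln n%:R ->
  (mu_ext P [set w | (t%:E <= ereal_sup [set `|Mt w x y - Mfun F x y|%:E
      | y in [set: R] & x in I])%E] <= ((10 + 8 * K%:R / p ^+ 2) / ln n%:R)%:E)%E.
Proof.
move=> IE minp t0 tE.
have N0 : 0 < n%:R * p / 2 by rewrite divr_gt0// mulr_gt0.
have win v : I v -> exists2 k : 'I_K, true & [set (k.+1)%:R] `<=` [set v].
  rewrite IE => -[k /andP[k1 kK] <-].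
  have kK' : (k.-1 < K)%N by rewrite prednK.
  by exists (Ordinal kK') => //= r ->; rewrite prednK.
rewrite -[t]add0r.
apply: (@finite_sample_rate _ _ _ P I F n X Y Mt Finc XY est B tau B0 tail tau0 tau_n
  n_tau ln1 n_ln I K (fun k => [set (k.+1)%:R]) predT (n%:R * p / 2) t 0 0
  (8 * K%:R / p ^+ 2)) => //.
- move=> i k _.
  have kK : k.+1 \in index_iota 1 K.+1 by rewrite mem_index_iota/= ltnS.
  apply: (le_trans _ (bigmine_le (fun j => P (X i @^-1` [set j%:R])) kK)).
  rewrite minp lee_fin.
  have -> : 3 / 2 * (n%:R * p / 2) / n%:R = 3 / 4 * p by field; rewrite gt_eqF.
  have := p0; lra.
- by move=> v /win[k _ kv]; exists k => // r /kv ->; rewrite /= in_itv/= subr0 lexx.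
- by move=> v /win[k _ kv]; exists k => // r /kv ->; rewrite /= in_itv/= addr0 lexx.
- by move=> v v' z _ _; rewrite normr_le0 subr_eq0 => /eqP ->; rewrite subrr normr0.
- have n1 : n%:R != 0 :> R by rewrite gt_eqF.
  have p1 : p != 0 by rewrite gt_eqF.
  have -> : K%:R * (2 * n%:R / (n%:R * p / 2) ^+ 2) = 8 * K%:R / p ^+ 2 * n%:R^-1.
    by field; rewrite n1 p1.
  apply: ler_wpM2l; last by rewrite lef_pV2 ?posrE.
  by apply: divr_ge0; [rewrite mulr_ge0|rewrite exprn_ge0// ltW].
Qed.

Hypothesis I_itv : is_interval I.
Hypothesis density : forall i : 'I_n, exists f : R -> R,
  [/\ measurable_fun setT f, forall t, 0 <= f t,
      forall D, measurable D -> distribution P (X i) D =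
        (\int[lebesgue_measure]_(t in D) (f t)%:E)%E &
      forall t, I t -> p <= f t].

Lemma interval_mass i (a b : R) : a <= b -> `[a, b] `<=` I ->
  ((p * (b - a))%:E <= P (X i @^-1` `[a, b]))%E.
Proof.
move=> ab abI; have [f [mf f0 fP fp]] := density i.
have -> : P (X i @^-1` `[a, b]) = (\int[lebesgue_measure]_(t in `[a, b]) (f t)%:E)%E.
  by rewrite -fP.
apply: (@le_trans _ _ (\int[lebesgue_measure]_(t in `[a, b]) (cst p%:E) t)%E).
  rewrite integral_cst//= lebesgue_measure_itv/= lte_fin.
  case: ltP => [_|ba]; first by rewrite -EFinB -EFinM.
  by rewrite mule0 lee_fin pmulr_rle0// subr_le0.
apply: ge0_le_integral => //.
- by move=> t _; rewrite lee_fin ltW.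
- by apply/measurable_EFinP; exact: measurable_funTS.
- by move=> t tab; rewrite lee_fin fp//; exact: abI.
Qed.

(** The lower bound on the density forces [I] to be bounded, which makes finitely many windows
    suffice. *)
Lemma interval_length (a b : R) : I a -> I b -> p * (b - a) <= 1.
Proof.
move=> Ia Ib; have [ab|ba] := leP a b; last first.
  by rewrite (le_trans _ ler01)// pmulr_rle0// subr_le0 ltW.
have abI : `[a, b] `<=` I by move=> t; rewrite /= in_itv/=; exact: I_itv.
rewrite -lee_fin (le_trans (interval_mass (Ordinal n0) ab abI))//.
by rewrite probability_le1//; exact: measurable_funPTI.
Qed.

Variables (Lip delta : R).
Hypothesis lip : forall v v' y, I v -> I v' ->
  `|Mfun F v y - Mfun F v' y| <= Lip * `|v - v'|.
Hypotheses (Lip0 : 0 < Lip) (delta0 : 0 < delta).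
Hypothesis delta3 : n%:R * delta ^+ 3 = B ^+ 2 * ln n%:R.

Let J : set R := [set x | [/\ I x, I (x - delta) & I (x + delta)]].

(* Windows of length [3/4 delta] on a mesh of width [delta/4]: every interval of
   length [delta] contains one of them. *)
Let window (a : R) (k : nat) : set R :=
  `[a + k%:R * (delta / 4), a + (k%:R + 3) * (delta / 4)].

Let window_ex (a s : R) : a <= s ->
  exists2 k, k%:R <= (s - a) / (delta / 4) + 1 & window a k `<=` `[s, s + delta].
Proof.
move=> as_; have dp := delta0; set z := (s - a) / (delta / 4).
have z0 : 0 <= z by rewrite divr_ge0 ?subr_ge0// divr_ge0// ltW.
have /andP[h1 h2] := truncn_itv z0.
(* The first mesh point beyond [s] is at most [delta / 4] away, which leaves room for a window of
   length [3 delta / 4]. *)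
exists (Num.truncn z).+1; first by rewrite -natr1 lerD2r.
have sE : s - a = z * (delta / 4) by rewrite /z divfK// gt_eqF// divr_gt0.
have d4 : 0 < delta / 4 by rewrite divr_gt0.
have e1 : z * (delta / 4) <= (Num.truncn z).+1%:R * (delta / 4).
  by rewrite ler_wpM2r// ltW.
have e2 : (Num.truncn z).+1%:R * (delta / 4) <= z * (delta / 4) + delta / 4.
  by rewrite -natr1 mulrDl mul1r lerD2r ler_wpM2r// ltW.
by move=> r; rewrite /window /= !in_itv/= mulrDl => /andP[r1 r2]; apply/andP; split; lra.
Qed.

Lemma continuous_rate :
  (mu_ext P [set w | (((4 * (Num.sqrt p)^-1 + Lip) * delta)%:E <=
      ereal_sup [set `|Mt w x y - Mfun F x y|%:E
      | y in [set: R] & x in J])%E] <= ((10 + 72 / p ^+ 3) / ln n%:R)%:E)%E.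
Proof.
have [pp dp] : 0 < p /\ 0 < delta by [].
have [p1 d1 n1] : [/\ p != 0, delta != 0 & n%:R != 0 :> R] by rewrite !gt_eqF.
have sp : Num.sqrt p ^+ 2 = p by rewrite sqr_sqrtr// ltW.
have sp0 : 0 < Num.sqrt p by rewrite sqrtr_gt0.
(* A window has mass at least [3 p delta / 4], which is [3 N / (2 n)] for this [N]. *)
have N0 : 0 < n%:R * p * delta / 2 by rewrite divr_gt0// !mulr_gt0.
have t0 : 0 <= 4 * (Num.sqrt p)^-1 * delta.
  by rewrite !mulr_ge0 ?invr_ge0// ltW.
have Nt : n%:R * p * delta / 2 * (4 * (Num.sqrt p)^-1 * delta) ^+ 2 =
    8 * B ^+ 2 * ln n%:R.
  rewrite -[RHS]mulrA -delta3 -[X in n%:R * X * delta]sp.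
  by field; rewrite gt_eqF.
have JI v : J v -> I v by case.
have near v v' z : J v -> I v' -> `|v' - v| <= delta ->
    `|Mfun F v' z - Mfun F v z| <= Lip * delta.
  by move=> [Iv _ _] Iv' vd; apply: (le_trans (lip _ Iv' Iv)); rewrite ler_wpM2l// ltW.
have -> : (4 * (Num.sqrt p)^-1 + Lip) * delta = Lip * delta + 4 * (Num.sqrt p)^-1 * delta.
  by rewrite mulrDl addrC.
have D0 : 0 <= 72 / p ^+ 3 by rewrite divr_ge0// exprn_ge0// ltW.
(* A point of [J] anchors the mesh and yields [2 p delta <= 1]; for an empty [J] the family of
   windows is empty as well. *)
have [[v0 Jv0]|J0] := pselect (exists v, J v); last first.
  have nJ v : ~ J v by move=> Jv; apply: J0; exists v.
  apply: (@finite_sample_rate _ _ _ P I F n X Y Mt Finc XY est B tau B0 tail tau0 tau_n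
    n_tau ln1 n_ln J 0 (fun=> set0) predT _ _ delta _ _ _ _ N0 t0 JI _ _ near Nt) => //.
  - by move=> i [].
  - by move=> v /nJ.
  - by move=> v /nJ.
  - by rewrite mul0r divr_ge0// ltW.
have [Iv0 Il Ir] := Jv0.
have pd : p * delta <= 1 / 2.
  have := interval_length Il Ir.
  have -> : p * (v0 + delta - (v0 - delta)) = 2 * (p * delta) by ring.
  lra.
have pd0 : 0 < p * delta by rewrite mulr_gt0.
(* By the length bound [I] lies within [1 / p] of [v0], so a mesh of width [delta / 4] starting at
   [a] needs [8 / (p delta)] steps to pass it; the two extra indices in [m] account for rounding and
   for the shift in [window_ex]. *)
pose a := v0 - p^-1.
have Ia v : I v -> a <= v.
  move=> Iv; have := interval_length Iv Iv0; rewrite mulrC -ler_pdivlMr// div1r /a; lra.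
have Ib v : I v -> v - a <= 2 / p.
  move=> Iv; have := interval_length Iv0 Iv; rewrite mulrC -ler_pdivlMr// div1r /a; lra.
pose m := (Num.truncn (8 / (p * delta))).+2.
have z0 : 0 <= 8 / (p * delta) by rewrite divr_ge0// ltW.
have /andP[m1 m2] := truncn_itv z0.
have km (k : nat) s : I s -> k%:R <= (s - a) / (delta / 4) + 1 -> (k < m)%N.
  move=> Is hk; rewrite -(ltr_nat R) /m -natr1.
  apply: (le_lt_trans hk); rewrite ltrD2r; apply: le_lt_trans m2.
  rewrite ler_pdivrMr ?divr_gt0// (le_trans (Ib _ Is))//.
  rewrite le_eqVlt; apply/orP; left; apply/eqP.
  by field; rewrite ?p1 ?d1 ?n1.
(* The mesh may leave [I], where the density has no lower bound; only windows inside [I] are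
   kept. *)
have wnd s : I s -> I (s + delta) ->
    exists2 k : 'I_m, `[< window a k `<=` I >] & window a k `<=` `[s, s + delta].
  move=> Is Isd; have [k hk kw] := window_ex (Ia _ Is).
  exists (Ordinal (km _ _ Is hk)) => //; apply/asboolP => r /kw.
  by rewrite /= in_itv/=; exact: I_itv.
apply: (@finite_sample_rate _ _ _ P I F n X Y Mt Finc XY est B tau B0 tail tau0 tau_n
    n_tau ln1 n_ln J m (fun k => window a k) (fun k => `[< window a k `<=` I >]) _ _ delta
    _ _ _ _ N0 t0 JI _ _ near Nt) => //.
- by move=> k; exact: measurable_itv.
- move=> i k /asboolP kI.
  have le_w : a + k%:R * (delta / 4) <= a + (k%:R + 3) * (delta / 4).
    by rewrite lerD2l ler_wpM2r ?divr_ge0 ?(ltW delta0)// lerDl.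
  apply: le_trans (interval_mass i le_w kI); rewrite lee_fin.
  rewrite le_eqVlt; apply/orP; left; apply/eqP.
  by field; rewrite gt_eqF.
- move=> v [Iv Il' _]; have := wnd _ Il'; rewrite subrK => /(_ Iv)[k Qk kw].
  by exists k.
- by move=> v [Iv _ Ir']; exact: wnd.
have mle : m%:R <= 9 / (p * delta).
  have -> : 9 / (p * delta) = 8 / (p * delta) + (p * delta)^-1.
    by field; rewrite p1 d1.
  have pd2 : 2 <= (p * delta)^-1 by rewrite -div1r ler_pdivlMr//; lra.
  by rewrite /m -addn2 natrD lerD.
apply: (@le_trans _ _ (9 / (p * delta) * (2 * n%:R / (n%:R * p * delta / 2) ^+ 2))).
  apply: ler_wpM2r => //.
  by apply: divr_ge0; [rewrite mulr_ge0|rewrite exprn_ge0// ltW].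
have -> : 9 / (p * delta) * (2 * n%:R / (n%:R * p * delta / 2) ^+ 2) =
    72 / p ^+ 3 / (n%:R * delta ^+ 3).
  by field; rewrite ?p1 ?d1 ?n1.
rewrite delta3; apply: ler_wpM2l => //.
rewrite lef_pV2 ?posrE//; last by rewrite mulr_gt0// exprn_gt0.
by rewrite ler_peMl ?(ltW l0)// expr_ge1// ltW.
Qed.

End covariate_windows.

(** * Asymptotics *)

Section truncation.
Context {R : realType}.
Implicit Types (lambda : R) (t : tail_setting) (n : nat).

(* Responses are truncated at a level exceeded by all of them with probability
   [o(1)]; [c_seq] and [boundary_width] are functions of this level. *)
Definition trunc_level lambda t n : R :=
  match t with
  | PolynomialTail => (n%:R * ln n%:R) `^ (1 / lambda)
  | ExponentialTail => 2 / lambda * ln n%:R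
  end.

(** The tail bound evaluated at [trunc_level]. Times [n] it is at most [1 / ln n], which makes the
    union over all responses negligible. *)
Definition trunc_mass t n : R :=
  match t with
  | PolynomialTail => (n%:R * ln n%:R)^-1
  | ExponentialTail => (n%:R ^+ 2)^-1
  end.

Lemma near_ln_natr_ge (M : R) : \forall n \near \oo, M <= ln n%:R.
Proof.
near=> n.
have Mn : expR M <= n%:R by near: n; exact: nbhs_infty_ger.
rewrite -ler_expR lnK// posrE; exact: lt_le_trans (expR_gt0 M) Mn.
Unshelve. all: by end_near. Qed.

Lemma cvg_inv_ln_natr (A : R) : (A / ln n%:R) @[n --> \oo] --> (0 : R).
Proof.
rewrite -(mulr0 A); apply: cvgMr.
have ln0 : \forall n \near \oo, 0 < ln (n%:R : R).
  near=> n; apply: (@lt_le_trans _ _ 1) => //.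
  by near: n; exact: near_ln_natr_ge.
by apply/(gtr0_cvgV0 ln0)/cvgryPge => M; exact: near_ln_natr_ge.
Unshelve. all: by end_near. Qed.

Lemma powR_expn (a x : R) k : 0 <= a -> (a `^ x) ^+ k = a `^ (x * k%:R).
Proof. by move=> a0; rewrite powRrM powR_mulrn// powR_ge0. Qed.

Lemma tail_boundedW (F : R -> cumulativeBounded (0 : R) (1 : R)) B tau x :
  (forall s, B <= s -> (abs_tail F x s <= (tau * B ^+ 2 / s ^+ 2)%:E)%E) ->
  tail_bounded F B tau x.
Proof.
move=> h s Bs; rewrite -!lee_fin; split.
  exact: le_trans (cdf_abs_tailN _ _ _) (h s Bs).
exact: le_trans (cdf_abs_tail _ _ _) (h s Bs).
Qed.

(** Here [lambda > 2] enters: with [s / B >= 1], the power [- lambda] of this ratio is at most its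
    inverse square. *)
Lemma powR_tail_le (lambda B s : R) : 2 < lambda -> 0 < B -> B <= s ->
  s `^ (- lambda) <= B `^ (- lambda) * B ^+ 2 / s ^+ 2.
Proof.
move=> l2 B0 Bs; have s0 : 0 < s by exact: lt_le_trans Bs.
have sB : 1 <= s / B by rewrite ler_pdivlMr// mul1r.
have sE : s = (s / B) * B by rewrite divfK// gt_eqF.
have r0 : 0 < s / B by rewrite divr_gt0.
rewrite sE; set r := s / B in sB r0 *.
have rl : r `^ (- lambda) <= r ^- 2.
  by rewrite -powR_invn ?(ltW r0)//; apply: ler_powR; rewrite ?lerN2 ?(ltW l2).
rewrite powRM ?(ltW r0) ?(ltW B0)//.
have -> : B `^ (- lambda) * B ^+ 2 / (r * B) ^+ 2 = r ^- 2 * B `^ (- lambda).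
  by field; rewrite !gt_eqF.
by rewrite ler_wpM2r// powR_ge0.
Qed.

(** By [1 + x <= expR x], the ratio [s / B] is at most [expR (lambda * (s - B) / 2)] once
    [1 / B <= lambda / 2]; squaring gives the envelope. *)
Lemma exp_tail_le (lambda B s : R) : 0 < lambda -> 2 / lambda <= B -> B <= s ->
  expR (- (lambda * s)) <= expR (- (lambda * B)) * B ^+ 2 / s ^+ 2.
Proof.
move=> l0 lB Bs.
have B0 : 0 < B by apply: lt_le_trans lB; rewrite divr_gt0.
have s0 : 0 < s by exact: lt_le_trans Bs.
have h : s / B <= expR (lambda * (s - B) / 2).
  apply: le_trans (expR_ge1Dx _).
  have -> : s / B = 1 + (s - B) / B by field; rewrite gt_eqF.
  rewrite lerD2l mulrAC mulrC ler_wpM2r ?subr_ge0//.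
  by rewrite -[leRHS]invf_div lef_pV2 ?posrE ?divr_gt0.
have h2 : (s / B) ^+ 2 <= expR (lambda * (s - B)).
  have -> : expR (lambda * (s - B)) = expR (lambda * (s - B) / 2) ^+ 2.
    by rewrite -expRM_natr; congr expR; field.
  by rewrite ler_pXn2r ?nnegrE ?expR_ge0// divr_ge0 ?(ltW s0) ?(ltW B0).
rewrite ler_pdivlMr ?exprn_gt0//.
have -> : expR (- (lambda * B)) = expR (- (lambda * s)) * expR (lambda * (s - B)).
  by rewrite -expRD; congr expR; ring.
rewrite -mulrA ler_wpM2l ?expR_ge0//.
by rewrite -ler_pdivrMr ?exprn_gt0// -expr_div_n.
Qed.

Lemma trunc_regime (I : set R) (F : R -> cumulativeBounded (0 : R) (1 : R)) lambda t :
  tail_condition I F lambda t ->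
  \forall n \near \oo, [/\ 1 <= trunc_level lambda t n,
    forall x, I x -> tail_bounded F (trunc_level lambda t n) (trunc_mass t n) x,
    0 <= trunc_mass t n, trunc_mass t n <= n%:R^-1 &
    n%:R * trunc_mass t n <= (ln n%:R)^-1].
Proof.
case: t => /= -[l0 [y0 y00 ty]]; near=> n; rewrite /trunc_level /trunc_mass.
- have n1 : 1 <= n%:R :> R by near: n; exact: nbhs_infty_ger.
  have l1 : 1 <= ln n%:R :> R by near: n; exact: near_ln_natr_ge.
  have lam0 : 0 < lambda by lra.
  have nl : n%:R <= n%:R * ln n%:R :> R by rewrite ler_peMr// (le_trans ler01).
  have nl0 : 0 < n%:R * ln n%:R :> R by rewrite (lt_le_trans _ nl)// (lt_le_trans ltr01).
  have BM (M : R) : 0 <= M -> M `^ lambda <= n%:R ->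
      M <= (n%:R * ln n%:R) `^ (1 / lambda).
    move=> M0 Mn.
    have -> : M = (M `^ lambda) `^ (1 / lambda).
      by rewrite -powRrM div1r mulfV ?gt_eqF// powRr1.
    apply: ge0_ler_powR; rewrite ?nnegrE ?powR_ge0 ?(ltW nl0)//.
      by rewrite divr_ge0// ltW.
    exact: le_trans nl.
  have B1 : 1 <= (n%:R * ln n%:R) `^ (1 / lambda) by apply: BM => //; rewrite powR1.
  have By : y0 <= (n%:R * ln n%:R) `^ (1 / lambda).
    by apply: BM => //; near: n; exact: nbhs_infty_ger.
  set B := _ `^ _ in B1 By *.
  have BE : B `^ (- lambda) = (n%:R * ln n%:R)^-1.
    rewrite /B powRN -powRrM div1r mulVf ?gt_eqF// powRr1//; exact: ltW.
  split => //.
  + move=> x Ix; apply: tail_boundedW => s Bs.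
    apply: (le_trans (ty s x (le_trans By Bs) _ Ix)).
      exact: lt_le_trans (lt_le_trans ltr01 B1) Bs.
    by rewrite lee_fin -BE powR_tail_le// (lt_le_trans ltr01).
  + by rewrite invr_ge0 ltW.
  + by rewrite lef_pV2 ?posrE// (lt_le_trans ltr01).
  + by rewrite invfM mulrA mulfV ?mul1r// gt_eqF// (lt_le_trans ltr01).
- have n1 : 1 <= n%:R :> R by near: n; exact: nbhs_infty_ger.
  have n0 : 0 < n%:R :> R by exact: lt_le_trans ltr01 n1.
  have l1 : 1 <= ln n%:R :> R by near: n; exact: near_ln_natr_ge.
  have lB : 2 / lambda <= 2 / lambda * ln n%:R by rewrite ler_peMr// divr_ge0// ltW.
  have BM (M : R) : M * lambda / 2 <= ln n%:R -> M <= 2 / lambda * ln n%:R.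
    have -> : 2 / lambda * ln n%:R = ln n%:R / (lambda / 2).
      by field; rewrite gt_eqF.
    by rewrite -mulrA -ler_pdivlMr// divr_gt0.
  have B1 : 1 <= 2 / lambda * ln n%:R.
    by apply: BM; near: n; exact: near_ln_natr_ge.
  have By : y0 <= 2 / lambda * ln n%:R.
    by apply: BM; near: n; exact: near_ln_natr_ge.
  set B := 2 / lambda * ln n%:R in lB B1 By *.
  have BE : expR (- (lambda * B)) = (n%:R ^+ 2)^-1.
    have -> : lambda * B = 2 * ln n%:R by rewrite /B; field; rewrite gt_eqF.
    by rewrite expRN expRM_natl lnK ?posrE.
  split => //.
  + move=> x Ix; apply: tail_boundedW => s Bs.
    apply: (le_trans (ty s x (le_trans By Bs) Ix)).
    by rewrite lee_fin -BE exp_tail_le.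
  + by rewrite lef_pV2 ?posrE ?exprn_gt0// expr2 ler_peMr// ltW.
  + have -> : n%:R * (n%:R ^+ 2)^-1 = n%:R^-1 :> R by field; rewrite gt_eqF.
    rewrite lef_pV2 ?posrE// ?(lt_le_trans ltr01)//.
    by rewrite ln_natr_le// -(ltr0n R).
Unshelve. all: by end_near. Qed.

End truncation.

(** * The rates as functions of the truncation level *)

Section sequences.
Context {R : realType} (n : nat) (p lambda : R) (t : tail_setting).
Hypotheses (p0 : 0 < p) (lambda0 : 0 < lambda).
Hypotheses (n0 : 0 < n%:R :> R) (ln0 : 0 < ln n%:R :> R).
Local Notation B := (trunc_level lambda t n).

Let sqrt_powR : p `^ (- (1 / 2)) = (Num.sqrt p)^-1.
Proof. by rewrite powRN div1r powR12_sqrt// ltW. Qed.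

Lemma boundary_width_gt0 : 0 < boundary_width lambda t n.
Proof.
by case: t => /=; rewrite !mulr_gt0 ?powR_gt0// divr_gt0.
Qed.

(** The width of the excluded boundary strip is the window length [delta]: a point needs a full
    window inside [I] on either side, and this equation balances noise and bias. *)
Lemma boundary_width_cube :
  n%:R * boundary_width lambda t n ^+ 3 = B ^+ 2 * ln n%:R.
Proof.
case: t => /=.
- rewrite exprMn !powR_expn ?(ltW n0) ?(ltW ln0) ?mulr_ge0 ?(ltW n0) ?(ltW ln0)//.
  have -> : (- (1 / 3) + 2 / (3 * lambda)) * 3%:R = - 1 + 1 / lambda * 2%:R :> R.
    by field; rewrite gt_eqF.
  have -> : (1 / 3 + 2 / (3 * lambda)) * 3%:R = 1 + 1 / lambda * 2%:R :> R.
    by field; rewrite gt_eqF.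
  rewrite powRM ?(ltW n0) ?(ltW ln0)//.
  rewrite !powRD ?(gt_eqF n0) ?(gt_eqF ln0) ?implybT//.
  rewrite powR_inv1 ?(ltW n0)// powRr1 ?(ltW ln0)//.
  by field; rewrite gt_eqF.
- rewrite !exprMn !powR_expn ?(ltW n0) ?divr_ge0 ?(ltW lambda0)//.
  have -> : 2 / 3 * 3%:R = 2%:R :> R by field.
  have -> : - (1 / 3) * 3%:R = - 1 :> R by field.
  rewrite powR_inv1 ?(ltW n0)// powR_mulrn ?divr_ge0 ?(ltW lambda0)//.
  by field; rewrite !gt_eqF.
Qed.

Lemma c_seq_continuous (L : R) : c_seq p lambda (Defs.Continuous L) t n =
  (4 * (Num.sqrt p)^-1 + L) * boundary_width lambda t n.
Proof. by case: t => /=; rewrite sqrt_powR; ring. Qed.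

Lemma c_seq_discrete_ge0 K : 0 <= c_seq p lambda (Discrete R K) t n.
Proof.
by case: t => /=; rewrite !mulr_ge0 ?powR_ge0// invr_ge0 ltW.
Qed.

(** With [N = n p / 2] and no bias, the whole of [c_seq] is the noise term,
    [4 p^(-1/2) B (ln n / n)^(1/2)]. *)
Lemma c_seq_discrete_sqr K :
  n%:R * p / 2 * c_seq p lambda (Discrete R K) t n ^+ 2 = 8 * B ^+ 2 * ln n%:R.
Proof.
have n1 : n%:R != 0 :> R by rewrite gt_eqF.
have p1 : p != 0 by rewrite gt_eqF.
have l1 : lambda != 0 by rewrite gt_eqF.
have pE : (p `^ (- (1 / 2))) ^+ 2 = p^-1.
  by rewrite sqrt_powR exprVn sqr_sqrtr// ltW.
case: t => /=.
- rewrite !exprMn pE !powR_expn ?(ltW n0) ?(ltW ln0) ?mulr_ge0 ?(ltW n0) ?(ltW ln0)//.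
  have -> : (- (1 / 2) + 1 / lambda) * 2%:R = - 1 + 1 / lambda * 2%:R :> R by field.
  have -> : (1 / 2 + 1 / lambda) * 2%:R = 1 + 1 / lambda * 2%:R :> R by field.
  rewrite powRM ?(ltW n0) ?(ltW ln0)//.
  rewrite !powRD ?(gt_eqF n0) ?(gt_eqF ln0) ?implybT//.
  rewrite powR_inv1 ?(ltW n0)// powRr1 ?(ltW ln0)//.
  by field; rewrite n1 p1.
- rewrite !exprMn pE !powR_expn ?(ltW n0) ?(ltW ln0)//.
  have -> : - (1 / 2) * 2%:R = - 1 :> R by field.
  have -> : 3 / 2 * 2%:R = 3%:R :> R by field.
  rewrite powR_inv1 ?(ltW n0)// powR_mulrn ?(ltW ln0)//.
  by field; rewrite n1 p1 l1.
Qed.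

End sequences.

Lemma mu_ext_cvg0 d (T : measurableType d) (R : realType) (P : probability T R)
    (E : (set T)^nat) (A : R) :
  (\forall n \near \oo, (mu_ext P (E n) <= (A / ln n%:R)%:E)%E) ->
  mu_ext P (E n) @[n --> \oo] --> 0%E.
Proof.
move=> h; apply: (@squeeze_cvge _ _ _ _ (fun=> 0%E) _ (fun n => (A / ln n%:R)%:E)).
- by near=> n; apply/andP; split; [exact: mu_ext_ge0|near: n].
- exact: cvg_cst.
- apply: cvg_EFin; first exact: nearW.
  exact: cvg_inv_ln_natr.
Unshelve. all: by end_near. Qed.

(* The estimator between observed covariate values is an arbitrary choice, so the
   event need not be measurable; [mu_ext P] is the outer measure of [P], which
   equals [P] on measurable events. *)
Theorem theorem3p2 (R : realType) (d : measure_display)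
  (Omega : measurableType d) (P : probability Omega R)
  (I : set R) (F : R -> cumulativeBounded (0 : R) (1 : R))
  (X Y : forall n : nat, 'I_n -> {RV P >-> R})
  (Mt : nat -> Omega -> R -> R -> R)
  (p lambda : R) (c : covariate_setting R) (t : tail_setting)
  (hF1 : finite_first_moments I F)
  (hFinc : icv_increasing I F)
  (hXY : forall n : nat, sampling_model I F (X n) (Y n))
  (hMt : forall (n : nat) (w : Omega),
    is_estimator (fun i => X n i w) (fun i => Y n i w) I (Mt n w))
  (hc : covariate_condition I F X p c)
  (ht : tail_condition I F lambda t) :
  mu_ext P
    [set w | ((c_seq p lambda c t n)%:E <=
       ereal_sup [set `|Mt n w x y - Mfun F x y|%:E
                 | y in [set: R] & x in I_seq I lambda c t n])%E]
    @[n --> \oo] --> 0%E.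
Proof.
have near_n : \forall n \near \oo,
    [/\ 1 <= ln n%:R :> R, 1152 < n%:R * ln n%:R :> R & 0 < n%:R :> R].
  near=> n.
  have n1 : 1153 <= n%:R :> R by near: n; exact: nbhs_infty_ger.
  have l1 : 1 <= ln n%:R :> R by near: n; exact: near_ln_natr_ge.
  split => //; last lra.
  by apply: (@lt_le_trans _ _ n%:R); [lra|rewrite ler_peMr//; lra].
have regime := trunc_regime ht.
have lambda0 : 0 < lambda by case: (t) ht => -[] // ? _; lra.
case: c hc => [K [p0 [K0 IE minp]]|L [p0 [Iitv dens L0 lip]]].
- apply: (@mu_ext_cvg0 _ _ _ _ _ (10 + 8 * K%:R / p ^+ 2)).
  move: near_n regime; apply: filterS2 => n [ln1 n_ln n0] [B1 tail tau0 taun ntau].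
  have ln0 : 0 < ln n%:R :> R by exact: lt_le_trans ltr01 ln1.
  have c0 : 0 <= c_seq p lambda (Discrete R K) t n by exact: c_seq_discrete_ge0.
  have c2 : n%:R * p / 2 * c_seq p lambda (Discrete R K) t n ^+ 2 =
    8 * trunc_level lambda t n ^+ 2 * ln n%:R by exact: c_seq_discrete_sqr.
  rewrite /I_seq -IE.
  exact: (discrete_rate hFinc (hXY n) (hMt n) B1 p0 tail tau0 taun ntau ln1 n_ln IE (minp n)
    c0 c2).
- apply: (@mu_ext_cvg0 _ _ _ _ _ (10 + 72 / p ^+ 3)).
  move: near_n regime; apply: filterS2 => n [ln1 n_ln n0] [B1 tail tau0 taun ntau].
  have ln0 : 0 < ln n%:R :> R by exact: lt_le_trans ltr01 ln1.
  rewrite c_seq_continuous//.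
  have lip' v v' y : I v -> I v' -> `|Mfun F v y - Mfun F v' y| <= L * `|v - v'|.
    by move=> Iv Iv'; exact: lip.
  have w0 : 0 < boundary_width lambda t n by exact: boundary_width_gt0.
  have w3 : n%:R * boundary_width lambda t n ^+ 3 = trunc_level lambda t n ^+ 2 * ln n%:R.
    exact: boundary_width_cube.
  exact: (continuous_rate hFinc (hXY n) (hMt n) B1 p0 tail tau0 taun ntau ln1 n_ln Iitv
    (dens n) lip' L0 w0 w3).
Unshelve. all: by end_near. Qed.
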